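(* Assume that conditions (A-i) and (A-ii) of the context hold, that $\bar\Sigma_m\in\mathcal U(r,s_0,M,\varepsilon_0)$, and that $d=o(m^{q/8})$. If the threshold is selected as $$t=t_{th}=C_{th}\frac{d^{4/q}}{\sqrt m}$$ for some large enough constant $C_{th}$, then the thresholded sample covariance matrix is consistent for $\bar\Sigma_m$ in the operator norm with $$\|\mathcal S_t\hat\Sigma_m-\bar\Sigma_m\|_{op}=O_{\mathbb P}\Big(\Big(\frac{d^{4/q}}{\sqrt m}\Big)^{1-r}\Big),\qquad m\to\infty .$$
   Context: Model. $m\in\mathbb N$ is the sample size, $d=d_m$ the dimension. Let $(\epsilon_t)_{t\in\mathbb Z}$ be i.i.d. uniform on $(0,1)$ and $(\epsilon_t')$ an independent copy. Put $\boldsymbol\epsilon_t=(\epsilon_t,\epsilon_{t-1},\dots)$ and, for $j\le t$, $\boldsymbol\epsilon_{t,j}=(\epsilon_t,\dots,\epsilon_{j+1},\epsilon_j',\epsilon_{j-1},\dots)$. The observations are $Y_t=(Y_{t1},\dots,Y_{td})^\top=G_t(\boldsymbol\epsilon_t)$, $t\ge1$, with measurable maps $G_t=(G_{tj})_{j=1}^d:\mathbb R^\infty\to\mathbb R^d$; everything may depend on $m$. $\mu_t=(\mu_{tj})_j=\mathbb EY_t$. Constants in the conditions are independent of $d$ and $m$. (A-i) For some $\beta>2$, $q>4$ and constants $K,C_1$: $\|\mu_t\|_\infty\le K$, $(\mathbb E|G_{tj}(\boldsymbol\epsilon_0)-\mu_{tj}|^q)^{1/q}\le K$ and $(\mathbb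 E|G_{tj}(\boldsymbol\epsilon_t)-G_{tj}(\boldsymbol\epsilon_{t,t-\ell})|^q)^{1/q}\le C_1\ell^{-\beta}$ for all $1\le j\le d$, $\ell\ge1$, $t\ge1$. (A-ii) There is $L>0$ such that $\max_{1\le j\le d}\sum_{t=2}^n(\mathbb E|G_{tj}(\boldsymbol\epsilon_0)-G_{t-1,j}(\boldsymbol\epsilon_0)|^4)^{1/4}\le KL$ for all $n\ge1$. Estimators. $\hat\mu_m=\frac1m\sum_{t=1}^mY_t$, $\hat\Sigma_m=\frac1m\sum_{t=1}^m(Y_t-\hat\mu_m)(Y_t-\hat\mu_m)^\top$, $\hat M_m=\frac1m\sum_{t=1}^mY_tY_t^\top$, $\bar\mu_m=\mathbb E\hat\mu_m$, $\bar M_m=\mathbb E\hat M_m$, $\bar\Sigma_m=\bar M_m-\bar\mu_m\bar\mu_m^\top$. Class. For $0\le r<1$ and constants $M$, $\varepsilon_0$, $s_0=s_0(d)$, $$\mathcal U(r,s_0,M,\varepsilon_0)=\Big\{\Sigma:\ \Sigma_{ii}\le M,\ \sum_{j=1}^d|\Sigma_{ij}|^r\le s_0,\ 1\le i\le d,\ \lambda_{\min}(\Sigma)\ge\varepsilon_0>0\Big\}.$$ Thresholding. $\mathcal S_t$ is a soft-thresholding operator with threshold $t$: a map on $\mathbb R^{d\times d}$ acting entrywise with, for all $x\in\mathbb R$: $|\mathcal S_t(x)|\le|x|$; $\mathcal S_t(x)=0$ for $|x|\le t$; $|\mathcal S_t(x)-x|\le t$. $\|\cdot\|_{op}$ is the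 spectral norm.
   Formalization: The sparsity bound s_0 = s_0(d) is additionally assumed to be bounded by a constant not depending on d and m; without this the stated rate, which contains no factor s_0, fails. *)

(* Defs.v *)
From HB Require Import structures.
From mathcomp Require Import all_boot all_order all_algebra.
From mathcomp Require Import all_classical all_reals all_analysis.

Set Implicit Arguments.
Unset Strict Implicit.
Unset Printing Implicit Defensive.

Import Order.TTheory GRing.Theory Num.Theory.
Import numFieldNormedType.Exports.

Local Open Scope classical_set_scope.
Local Open Scope ring_scope.

Section probability_notions.
Context {disp : measure_display} {Omega : measurableType disp} {R : realType}.
Variable P : probability Omega R.

Definition mutually_independent (I : eqType) (X : I -> {RV P >-> R}) : Prop :=
  forall (s : seq I) (A : I -> set R), uniq s -> (forall i, measurable (A i)) ->
    (P (\bigcap_(i in [set` s]) X i @^-1` A i) =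
     \prod_(i <- s) P (X i @^-1` A i))%E.

Definition uniform01 (X : {RV P >-> R}) : Prop :=
  forall A : set R, measurable A ->
    distribution P X A = uniform_prob (@ltr01 R) A.

(* The joint family of all the [e t] and all the [e' t] is i.i.d., i.e. [e] is
   i.i.d. and [e'] is an independent copy of it. *)
Definition iid_uniform_with_copy (e e' : int -> {RV P >-> R}) : Prop :=
  mutually_independent
    (fun u : int + int => match u with inl t => e t | inr t => e' t end) /\
  (forall t, uniform01 (e t) /\ uniform01 (e' t)).

(* [mu_ext P] is the outer measure of [P]; it coincides with [P] on events and
   avoids any measurability assumption on the [X m]. *)
Definition bigO_P (X : nat -> Omega -> R) (a : nat -> R) : Prop :=
  forall delta : R, 0 < delta -> exists2 B : R, 0 < B &
    \forall m \near \oo,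
      (mu_ext P [set w | (B * `|a m| < `|X m w|)%R] <= delta%:E)%E.

Definition mx_expectation (m n : nat) (X : Omega -> 'M[R]_(m, n)) : 'M[R]_(m, n) :=
  \matrix_(i, j) fine 'E_P[fun w => X w i j]%E.

End probability_notions.

Section model.
Context {disp : measure_display} {Omega : measurableType disp} {R : realType}.
Variable P : probability Omega R.
Variables e e' : int -> {RV P >-> R}.

(* (e_t, e_(t-1), ...) *)
Definition history (t : int) (w : Omega) : nat -> R :=
  fun k => e (t - k%:Z) w.

(* (e_t, ..., e_(j+1), e'_j, e_(j-1), ...) *)
Definition coupled_history (t j : int) (w : Omega) : nat -> R :=
  fun k => if t - k%:Z == j then e' j w else e (t - k%:Z) w.

Definition cylinders : set (set (nat -> R)) :=
  \bigcup_k preimage_set_system setT (fun x : nat -> R => x k) measurable.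

Variables (d : nat) (G : nat -> (nat -> R) -> 'cV[R]_d).

Definition measurable_maps : Prop :=
  forall t j, (1 <= t)%N ->
    measurable_fun (setT : set (g_sigma_algebraType cylinders))
      (fun x : g_sigma_algebraType cylinders => G t x j 0).

Definition observation (t : nat) (w : Omega) : 'cV[R]_d := G t (history t%:Z w).

Definition mean_vector (t : nat) : 'cV[R]_d := mx_expectation P (observation t).

Definition cond_moment_decay (beta q K C1 : R) : Prop :=
  forall t : nat, (1 <= t)%N ->
    mx_norm (mean_vector t) <= K /\
    forall j : 'I_d,
      (Lnorm P q%:E (fun w => (G t (history 0 w) j 0 - mean_vector t j 0)%:E)
        <= K%:E)%E /\
      forall l : nat, (1 <= l)%N ->
        (Lnorm P q%:E (fun w => (G t (history t%:Z w) j 0 -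
              G t (coupled_history t%:Z (t%:Z - l%:Z) w) j 0)%:E)
          <= (C1 * l%:R `^ (- beta))%:E)%E.

Definition cond_variation (K L : R) : Prop :=
  forall n : nat, (1 <= n)%N -> forall j : 'I_d,
    (\sum_(2 <= t < n.+1)
        Lnorm P 4%:E
          (fun w => (G t (history 0 w) j 0 - G t.-1 (history 0 w) j 0)%:E)
      <= (K * L)%:E)%E.

End model.

Section estimators.
Context {disp : measure_display} {Omega : measurableType disp} {R : realType}.
Variables (P : probability Omega R) (d : nat) (Y : nat -> Omega -> 'cV[R]_d).
Variable m : nat.

Definition sample_mean (w : Omega) : 'cV[R]_d :=
  m%:R^-1 *: \sum_(1 <= t < m.+1) Y t w.

Definition sample_cov (w : Omega) : 'M[R]_d :=
  m%:R^-1 *: \sum_(1 <= t < m.+1)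
    (Y t w - sample_mean w) *m (Y t w - sample_mean w)^T.

Definition sample_second_moment (w : Omega) : 'M[R]_d :=
  m%:R^-1 *: \sum_(1 <= t < m.+1) Y t w *m (Y t w)^T.

Definition avg_mean : 'cV[R]_d := mx_expectation P sample_mean.

Definition avg_second_moment : 'M[R]_d := mx_expectation P sample_second_moment.

Definition avg_cov : 'M[R]_d := avg_second_moment - avg_mean *m avg_mean^T.

End estimators.

Section matrices.
Context {R : realType}.

Definition l2norm (n : nat) (x : 'cV[R]_n) : R :=
  Num.sqrt (\sum_i x i 0 ^+ 2).

Definition opnorm (n : nat) (A : 'M[R]_n) : R :=
  sup [set l2norm (A *m x) | x in [set x : 'cV[R]_n | l2norm x <= 1]].

(* Only meant for symmetric matrices of positive size, whose set of real
   eigenvalues is nonempty and finite. *)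
Definition lambda_min (n : nat) (A : 'M[R]_n) : R :=
  inf [set a : R | eigenvalue A a].

(* The sum is restricted to the nonzero entries because of the convention
   0 ^ 0 = 0 of the case r = 0, whereas [powR 0 0 = 1]; for r > 0 the
   restriction is immaterial. *)
Definition sparse_class (r s0 M eps0 : R) (n : nat) : set 'M[R]_n :=
  [set A : 'M[R]_n | (forall i, A i i <= M /\
              \sum_(j | A i j != 0) `|A i j| `^ r <= s0) /\
           eps0 <= lambda_min A].

Definition soft_threshold (t : R) (f : R -> R) : Prop :=
  forall x, [/\ `|f x| <= `|x|, `|x| <= t -> f x = 0 & `|f x - x| <= t].

Definition rate (q : R) (d m : nat) : R := d%:R `^ (4 / q) / Num.sqrt m%:R.

End matrices.

(* Main.v *)
From HB Require Import structures.
Require Import Defs.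
From mathcomp Require Import all_boot all_order all_algebra.
From mathcomp Require Import all_classical all_reals all_analysis.
From mathcomp Require Import measurable_realfun.
From mathcomp Require Import ring lra.

(** The proof has a probabilistic part, which controls the moments of order
    [q / 2] of every entry of the error of the sample covariance, and a
    deterministic part, which turns them into a bound on the operator norm.

    The probabilistic part is an Efron-Stein inequality in [L^p], for [p > 2]:
    if [f] is a function of an i.i.d. sequence [X] and resampling the coordinate
    [k] moves [f] by at most [alpha k] in [L^p], then the norm of [f X - E f X]
    is at most a constant times the square root of the sum of the
    [alpha k ^+ 2] ([moment_inequality]). Let [f] be centred, [phi u = u |u|^(p-2)]
    and [S N] the sequence [X] whose first [N] coordinates come from an
    independent copy. Then [E |f X|^p = E (phi (f X) f X)] equals the sum over
    [k < N] of [E (phi (f X) (f (S k) - f (S k.+1)))], plus [E (phi (f X) f (S N))].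
    The last term tends to 0, because in the limit [S N] becomes independent of
    [X] ([splice_mean_cvg] and [mean_independent]). Exchanging the two coordinates
    [k] preserves the law and changes the sign of the [k]-th increment, so that
    [phi (f X)] may be replaced by half its own increment; by
    [signed_power_lipschitz] and [mul3_le_powR] the [k]-th term is then at most a
    constant times [alpha k ^+ 2 ||f X||^(p-2)]. The structure of the law enters
    through exchangeability and a form of the zero-one law only.

    A sum of [m] terms of a causal process whose coupling coefficients are
    summable then has an [L^p] norm of order the square root of [m]
    ([partial_sum_norm_le]). Applied to the observations with [p = q] and to the
    products of two components with [p = q / 2], this bounds every entry of the
    error of the sample covariance by a multiple of [m^(-1/2)] in [L^(q/2)]
    ([covariance_entry_norm_le]). As the power [q / 2] of the rate
    [d^(4/q) / m^(1/2)] is [d^2 m^(-q/4)], the sum of the [q / 2]-th powers of all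
    [d^2] errors is, up to a constant, at most that power of the rate with large
    probability.

    On this event some entries may still be estimated with an error above half
    the threshold: for a fixed [Cth], moments of order [q / 2] do not make the
    probability of that tend to 0. The well estimated entries are handled by
    sparsity and Schur's test. The others have a squared Frobenius norm of the
    order of the squared rate, because [q / 2 > 2] and these errors exceed half
    the threshold, so that their squares are dominated by their [q / 2]-th powers
    ([threshold_opnorm]).
    Hence any positive [Cth] is large enough, and [C0 = 1] is a valid choice. *)

Set Implicit Arguments.
Unset Strict Implicit.
Unset Printing Implicit Defensive.

Import Order.TTheory GRing.Theory Num.Theory.
Import numFieldNormedType.Exports.
Local Open Scope classical_set_scope.
Local Open Scope ring_scope.

(** * Power inequalities *)

Section signed_power.
Context {R : realType}.
Implicit Types a b u v w : R.

(** Up to the factor [p], the derivative of [|a|^p]; testing a variable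
    against its signed power produces its [p]-th absolute moment. *)
Definition signed_power (p a : R) : R := a * `|a| `^ (p - 2).

Lemma mul_signed_power p a : 2 < p -> signed_power p a * a = `|a| `^ p.
Proof.
move=> p2; rewrite /signed_power mulrAC -expr2 -real_normK ?num_real//.
rewrite -powR_mulrn// -powRD; first by rewrite addrCA subrr addr0.
by apply/implyP => /eqP; lra.
Qed.

(** Bernoulli's inequality; comparing with the integer power [r ^+ n <= r `^ s]
    reduces it to an induction on [n]. *)
Lemma onem_powR_le (r s : R) (n : nat) : 0 <= r <= 1 -> 0 <= s -> s <= n%:R ->
  1 - r `^ s <= n%:R * (1 - r).
Proof.
move=> /andP[r0 r1] s0 sn.
have : r ^+ n <= r `^ s.
  rewrite -powR_mulrn//; have [->|rn0] := eqVneq r 0; last first.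
    by apply: ger_powR => //; rewrite lt0r rn0 r0.
  have [->|sn0] := eqVneq s 0.
    by rewrite powRr0 /powR eqxx; case: (_ == _).
  have n0 : n%:R != 0 :> R by rewrite gt_eqF// (lt_le_trans _ sn)// lt0r sn0.
  by rewrite !powR0.
have : 1 - r ^+ n <= n%:R * (1 - r).
  elim: n {sn} => [|n IH]; first by rewrite expr0 mul0r subrr.
  rewrite exprS -natr1; have : r * (1 - r ^+ n) <= 1 - r ^+ n.
    by rewrite ler_piMl// subr_ge0 exprn_ile1.
  by move: IH; nra.
lra.
Qed.

(** With [s = p - 2] and [|b| <= |a|], the difference is
    [(a - b) |a|^s + b (|a|^s - |b|^s)]; dividing by [|a|^(s+1)], the second term
    is controlled by Bernoulli's inequality at the ratio [|b| / |a|]. *)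
Lemma signed_power_lipschitz p (n : nat) a b : 2 < p -> p - 2 <= n%:R ->
  `|signed_power p a - signed_power p b| <=
    n.+1%:R * (`|a - b| * (`|a| `^ (p - 2) + `|b| `^ (p - 2))).
Proof.
move=> p2 pn; have s0 : 0 <= p - 2 by lra.
wlog ba : a b / `|b| <= `|a|.
  move=> H; have [/H //|/ltW /H] := leP `|b| `|a|.
  by rewrite distrC (distrC b) (addrC (`|b| `^ _)).
set s := p - 2 in pn s0 *.
have h0 : 0 <= `|a| `^ s by exact: powR_ge0.
have g0 : 0 <= `|b| `^ s by exact: powR_ge0.
suff key : `|b| * (`|a| `^ s - `|b| `^ s) <= n%:R * (`|a| - `|b|) * `|a| `^ s.
  have -> : signed_power p a - signed_power p b =
      (a - b) * `|a| `^ s + b * (`|a| `^ s - `|b| `^ s).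
    by rewrite /signed_power -/s; ring.
  apply: (le_trans (ler_normD _ _)); rewrite !normrM (ger0_norm h0).
  rewrite (@ger0_norm _ (`|a| `^ s - _)) ?subr_ge0 ?ge0_ler_powR ?nnegrE//.
  apply: (le_trans (lerD (lexx _) key)).
  have : n%:R * (`|a| - `|b|) * `|a| `^ s <= n%:R * `|a - b| * `|a| `^ s.
    by rewrite ler_wpM2r// ler_wpM2l// lerB_dist.
  move=> /(lerD (lexx (`|a - b| * `|a| `^ s))) /le_trans; apply.
  rewrite (_ : _ + _ = n.+1%:R * (`|a - b| * `|a| `^ s)).
    by do 2 rewrite ler_wpM2l//; rewrite lerDl.
  by rewrite -natr1; ring.
have [a0|a0] := eqVneq `|a| 0.
  have b0 : `|b| = 0 by apply/eqP; rewrite eq_le normr_ge0 -{1}a0 ba.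
  by rewrite a0 b0 mul0r subrr mulr0 mul0r.
have {}a0 : 0 < `|a| by rewrite lt0r a0/=.
set r := `|b| / `|a|.
have r01 : 0 <= r <= 1 by rewrite divr_ge0//= ler_pdivrMr// mul1r.
have bE : `|b| = r * `|a| by rewrite divfK// gt_eqF.
have -> : `|b| `^ s = r `^ s * `|a| `^ s by rewrite bE powRM// ?(andP r01).1.
have := onem_powR_le r01 s0 pn; case/andP: r01 => r0 r1 k.
rewrite bE (_ : _ * _ = (r * (1 - r `^ s)) * (`|a| * `|a| `^ s)); last by ring.
rewrite (_ : n%:R * _ * _ = (n%:R * (1 - r)) * (`|a| * `|a| `^ s)); last by ring.
apply: ler_wpM2r; first by rewrite mulr_ge0.
apply: le_trans k; rewrite ler_piMl// subr_ge0.
rewrite (_ : 1 = 1 `^ s); last by rewrite powR1.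
by apply: ge0_ler_powR => //; rewrite nnegrE.
Qed.

(** A substitute for Hoelder's inequality with three factors: once [u], [v] and
    [w] are measured in the units [A], [A] and [B], the left-hand side has degree
    [p] and is at most the [p]-th power of the largest variable. When [u] and [v]
    have [L^p] norm at most [A] and [w] has norm at most [B], the expectation of
    the right-hand side is at most [3 A^2 B^(p-2)]. *)
Lemma mul3_le_powR p u v w (A B : R) : 2 < p -> 0 < A -> 0 < B ->
  0 <= u -> 0 <= v -> 0 <= w ->
  u * (v * w `^ (p - 2)) <= A ^+ 2 * B `^ (p - 2) *
    ((A^-1) `^ p * u `^ p + (A^-1) `^ p * v `^ p + (B^-1) `^ p * w `^ p).
Proof.
move=> p2 A0 B0 u0 v0 w0.
have Ai : 0 <= A^-1 by rewrite invr_ge0 ltW.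
have Bi : 0 <= B^-1 by rewrite invr_ge0 ltW.
set x := A^-1 * u; set y := A^-1 * v; set z := B^-1 * w.
have [x0 y0 z0] : [/\ 0 <= x, 0 <= y & 0 <= z] by split; exact: mulr_ge0.
have -> : u * (v * w `^ (p - 2)) =
    A ^+ 2 * B `^ (p - 2) * (x * (y * z `^ (p - 2))).
  have -> : u = A * x by rewrite mulVKf ?gt_eqF.
  have -> : v = A * y by rewrite mulVKf ?gt_eqF.
  have -> : w = B * z by rewrite mulVKf ?gt_eqF.
  by rewrite powRM// ?(ltW B0)//; ring.
rewrite -!powRM// -/x -/y -/z; apply: ler_wpM2l.
  by rewrite mulr_ge0 ?sqr_ge0 ?powR_ge0.
have px := powR_ge0 x p; have py := powR_ge0 y p; have pz := powR_ge0 z p.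
suff H t : x <= t -> y <= t -> z <= t -> 0 <= t ->
    x * (y * z `^ (p - 2)) <= t `^ p.
  have [xy|/ltW yx] := leP x y.
    have [yz|/ltW zy] := leP y z.
      by apply: (le_trans (H z (le_trans xy yz) yz (lexx _) z0)); rewrite lerDr addr_ge0.
    by apply: (le_trans (H y xy (lexx _) zy y0)); lra.
  have [xz|/ltW zx] := leP x z.
    by apply: (le_trans (H z xz (le_trans yx xz) (lexx _) z0)); lra.
  by apply: (le_trans (H x (lexx _) yx zx x0)); lra.
move=> xt yt zt t0.
have -> : t `^ p = t * (t * t `^ (p - 2)).
  by have := mul_signed_power t p2; rewrite /signed_power ger0_norm// => <-; ring.
apply: ler_pM => //; first by rewrite mulr_ge0 ?powR_ge0.
apply: ler_pM => //; first exact: powR_ge0.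
by apply: ge0_ler_powR => //; lra.
Qed.

End signed_power.

(** * Independent families and their laws *)

(** The generator [cylinders] of the product sigma-algebra, for an arbitrary
    index type; for [I = nat] it is convertible to [cylinders]. *)
Definition coordinate_sets (R : realType) (I : Type) : set (set (I -> R)) :=
  \bigcup_k preimage_set_system setT (fun x : I -> R => x k) measurable.

Notation sequences R I := (g_sigma_algebraType (@coordinate_sets R I)).

Section cylinders.
Context {R : realType} {I : eqType}.

(** Boxes with finitely many constrained coordinates form a pi-system that
    generates the product sigma-algebra, and independence computes their
    probability: they determine the law of an independent family. *)
Definition box (s : seq I) (A : I -> set R) : set (I -> R) :=
  [set x | forall i, i \in s -> A i (x i)].

Definition boxes : set (set (I -> R)) :=
  [set B | exists (s : seq I) A, (forall i, measurable (A i)) /\ B = box s A].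

Lemma boxes_setI : setI_closed boxes.
Proof.
move=> _ _ [s [A [mA ->]]] [t [B [mB ->]]].
exists (s ++ t), (fun i => (if i \in s then A i else setT) `&`
                           (if i \in t then B i else setT)); split.
  by move=> i; apply: measurableI; case: ifP.
apply/seteqP; split => [x [sx tx] i _|x stx] /=.
  by split; case: ifPn => // ist; [exact: sx|exact: tx].
by split => i ist; have := stx i; rewrite mem_cat ist ?orbT => /(_ isT) [].
Qed.

Lemma measurable_coordinate (i : I) :
  measurable_fun setT (fun x : sequences R I => x i).
Proof.
move=> _ A mA; apply: sub_sigma_algebra; exists i => //.
by exists A => //; rewrite setTI.
Qed.

Lemma measurable_box (s : seq I) (A : I -> set R) :
  (forall i, measurable (A i)) -> measurable (box s A : set (sequences R I)).
Proof.
move=> mA; elim: s => [|i s IH].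
  by rewrite (_ : box _ _ = setT) //; apply/seteqP; split => // x _ i.
rewrite (_ : box _ _ = ((fun x : sequences R I => x i) @^-1` A i) `&` box s A).
  apply: measurableI => //; rewrite -[X in measurable X]setTI.
  exact: measurable_coordinate.
apply/seteqP; split=> [x xs|x [xi xs] j].
  by split=> [|j js]; apply: xs; rewrite inE ?eqxx ?js ?orbT.
by rewrite inE => /predU1P[->|]//; exact: xs.
Qed.

Lemma measurable_sequencesE :
  @measurable _ (sequences R I) = <<s boxes >>.
Proof.
apply/seteqP; split.
  apply: smallest_sub; first exact: smallest_sigma_algebra.
  move=> _ [i _ [A mA <-]]; rewrite setTI; apply: sub_sigma_algebra.
  exists [:: i], (fun=> A); split=> //; apply/seteqP; split=> x /=.
    by move=> Ax j; rewrite inE => /eqP ->.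
  by move=> /(_ i); rewrite inE eqxx; exact.
apply: smallest_sub; first exact: sigma_algebra_measurable.
by move=> _ [s [A [mA ->]]]; exact: measurable_box.
Qed.

Lemma measurable_to_sequences d (T : measurableType d) (Z : T -> I -> R) :
  (forall i, measurable_fun setT (fun w => Z w i)) ->
  measurable_fun setT (Z : T -> sequences R I).
Proof.
move=> mZ.
have := (@measurability _ _ T (sequences R I) setT Z (@coordinate_sets R I)).
apply => //.
move=> _ [_ [i _ [A mA <-]] <-].
have := mZ i measurableT _ mA; rewrite !setTI /preimage /=; exact.
Qed.

End cylinders.

Lemma measurable_reindex {R : realType} {I J : eqType} (a : J -> I) :
  measurable_fun setT
    ((fun x j => x (a j)) : sequences R I -> sequences R J).
Proof.
by apply: measurable_to_sequences => j; exact: measurable_coordinate.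
Qed.

Section laws.
Context {disp : measure_display} {Omega : measurableType disp} {R : realType}.
Variable P : probability Omega R.

Definition realisation {I : Type} (V : I -> {RV P >-> R}) (w : Omega) :
    sequences R I :=
  fun i => V i w.

Definition iid {I : eqType} (V : I -> {RV P >-> R}) : Prop :=
  mutually_independent V /\
  forall i j A, measurable A -> P (V i @^-1` A) = P (V j @^-1` A).

Lemma measurable_realisation {I : eqType} (V : I -> {RV P >-> R}) :
  measurable_fun setT (realisation V).
Proof. by apply: measurable_to_sequences => i; exact: measurable_funP. Qed.

HB.instance Definition _ (I : eqType) (V : I -> {RV P >-> R}) :=
  isMeasurableFun.Build _ _ Omega (sequences R I) (realisation V)
    (measurable_realisation V).

Lemma measurable_realisation_preimage {I : eqType} (V : I -> {RV P >-> R})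
    (B : set (sequences R I)) :
  measurable B -> measurable (realisation V @^-1` B).
Proof.
by move=> mB; rewrite -[_ @^-1` _]setTI; exact: measurable_realisation.
Qed.

(** An event on the subfamily is an event on the family: the set attached to
    the coordinate [a j] is recovered from the position of [a j] in the image of
    the finite list of constrained coordinates. *)
Lemma iid_reindex {I J : eqType} (V : I -> {RV P >-> R}) (a : J -> I) :
  injective a -> iid V -> iid (V \o a).
Proof.
move=> ia [Vind Vid]; split; last by move=> i j A mA; exact: Vid.
move=> s A us mA; case: s us => [|j0 s'] us.
  by have := Vind [::] (fun=> setT) isT (fun=> measurableT);
    rewrite !big_nil => <-; congr (P _); apply/seteqP; split => w.
move: (j0 :: s') us => {}s us {s'}.
pose B i := A (nth j0 s (index i (map a s))).
have Ba j : j \in s -> B (a j) = A j.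
  by move=> js; rewrite /B index_map// nth_index.
have := Vind (map a s) B; rewrite map_inj_uniq// => /(_ us (fun=> mA _)).
rewrite big_map => VE; transitivity (\prod_(j <- s) P (V (a j) @^-1` B (a j)))%E.
  rewrite -VE; congr (P _); apply/seteqP; split=> w /= H.
    by move=> i /= /mapP[j js ->] /=; rewrite Ba//; exact: H.
  by move=> j js /=; rewrite -Ba//; apply: H; exact: map_f.
by rewrite !big_seq; apply: eq_bigr => j js; rewrite Ba.
Qed.

Lemma law_box {I : eqType} (V : I -> {RV P >-> R}) s A :
  mutually_independent V -> (forall i, measurable (A i)) ->
  P (realisation V @^-1` box s A) =
    (\prod_(i <- undup s) P (V i @^-1` A i))%E.
Proof.
move=> Vind mA; rewrite -(Vind (undup s) A) ?undup_uniq//.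
congr (P _); apply/seteqP; split=> w /= H i /= si.
  by apply: H; rewrite -mem_undup.
by apply: (H i); rewrite /= mem_undup.
Qed.

Lemma law_unique {I : eqType} (V W : I -> {RV P >-> R}) :
  mutually_independent V -> mutually_independent W ->
  (forall i A, measurable A -> P (V i @^-1` A) = P (W i @^-1` A)) ->
  forall B : set (sequences R I), measurable B ->
  P (realisation V @^-1` B) = P (realisation W @^-1` B).
Proof.
move=> Vind Wind VW B mB.
change (distribution P (realisation V) B = distribution P (realisation W) B).
apply: (@measure_unique _ R (sequences R I) boxes (fun=> setT)) => //.
- exact: measurable_sequencesE.
- exact: boxes_setI.
- by move=> _; exists [::], (fun=> setT); split=> //; apply/seteqP; split.
- by rewrite bigcup_const.
- move=> _ [s [A [mA ->]]]; transitivity (\prod_(i <- undup s) P (V i @^-1` A i))%E.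
    exact: law_box.
  transitivity (\prod_(i <- undup s) P (W i @^-1` A i))%E; last first.
    by apply/esym; exact: law_box.
  by apply: eq_bigr => i _; exact: VW.
- by move=> _; apply: (@le_lt_trans _ _ 1%E); [exact: probability_le1|exact: ltry].
Qed.

End laws.

(** * Bounded random variables and exchangeability *)

Section bounded.
Context {disp : measure_display} {Omega : measurableType disp} {R : realType}.
Variable P : probability Omega R.
Implicit Types f g : Omega -> R.

Definition bounded_rv f : Prop :=
  measurable_fun setT f /\ exists c, forall w, `|f w| <= c.

Lemma bounded_rv_integrable f : bounded_rv f -> P.-integrable setT (EFin \o f).
Proof.
move=> [mf [c fc]]; apply: measurable_bounded_integrable => //.
  by rewrite (le_lt_trans (probability_le1 _ _)) ?ltry.
exists c; split; first exact: num_real.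
by move=> x cx w _ /=; rewrite (le_trans (fc w))// ltW.
Qed.

Lemma bounded_rv_cst c : bounded_rv (fun=> c).
Proof. by split=> //; exists `|c|. Qed.

Lemma bounded_rvD f g : bounded_rv f -> bounded_rv g ->
  bounded_rv (fun w => f w + g w).
Proof.
move=> [mf [c fc]] [mg [d gd]]; split; first exact: measurable_funD.
by exists (c + d) => w; rewrite (le_trans (ler_normD _ _))// lerD.
Qed.

Lemma bounded_rvM f g : bounded_rv f -> bounded_rv g ->
  bounded_rv (fun w => f w * g w).
Proof.
move=> [mf [c fc]] [mg [d gd]]; split; first exact: measurable_funM.
by exists (c * d) => w; rewrite normrM ler_pM.
Qed.

Lemma bounded_rvB f g : bounded_rv f -> bounded_rv g ->
  bounded_rv (fun w => f w - g w).
Proof.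
move=> [mf [c fc]] [mg [d gd]]; split; first exact: measurable_funB.
by exists (c + d) => w; rewrite (le_trans (ler_normB _ _))// lerD.
Qed.

Lemma bounded_rv_norm f : bounded_rv f -> bounded_rv (fun w => `|f w|).
Proof.
move=> [mf [c fc]]; split; first exact: measurableT_comp.
by exists c => w; rewrite normr_id.
Qed.

Lemma measurable_norm_powR f p : measurable_fun setT f ->
  measurable_fun setT (fun w => `|f w| `^ p).
Proof.
move=> mf; apply: (@measurableT_comp _ _ _ _ _ _ (@powR R ^~ p)) => //.
exact: measurableT_comp.
Qed.

Lemma bounded_rv_powR f p : 0 <= p -> bounded_rv f ->
  bounded_rv (fun w => `|f w| `^ p).
Proof.
move=> p0 [mf [c fc]]; split.
  exact: measurable_norm_powR.
exists (c `^ p) => w; rewrite ger0_norm ?powR_ge0//.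
by apply: ge0_ler_powR => //; rewrite ?nnegrE// (le_trans _ (fc w)).
Qed.

Lemma bounded_rv_sum (I : Type) (s : seq I) (F : I -> Omega -> R) :
  (forall i, bounded_rv (F i)) -> bounded_rv (fun w => \sum_(i <- s) F i w).
Proof.
move=> bF; elim: s => [|i s IH].
  by under eq_fun do rewrite big_nil; exact: bounded_rv_cst.
by under eq_fun do rewrite big_cons; exact: bounded_rvD.
Qed.

Lemma bounded_rv_indic A : measurable A -> bounded_rv \1_A.
Proof.
move=> mA; split; first exact: measurable_indic.
by exists 1 => w; rewrite indicE; case: (_ \in _); rewrite ?normr1 ?normr0.
Qed.

Lemma meanD f g : bounded_rv f -> bounded_rv g ->
  \int[P]_w (f w + g w) = \int[P]_w f w + \int[P]_w g w.
Proof. by move=> bf bg; rewrite RintegralD//; exact: bounded_rv_integrable. Qed.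

Lemma meanB f g : bounded_rv f -> bounded_rv g ->
  \int[P]_w (f w - g w) = \int[P]_w f w - \int[P]_w g w.
Proof. by move=> bf bg; rewrite RintegralB//; exact: bounded_rv_integrable. Qed.

Lemma meanZ c f : bounded_rv f -> \int[P]_w (c * f w) = c * \int[P]_w f w.
Proof. by move=> bf; rewrite RintegralZl//; exact: bounded_rv_integrable. Qed.

Lemma mean_cst c : \int[P]_w c = c.
Proof.
rewrite Rintegral_cst// -[RHS]mulr1; congr (_ * _).
by rewrite -[RHS]/(fine 1%E); congr fine; exact: probability_setT.
Qed.

Lemma mean_indic A : measurable A -> \int[P]_w \1_A w = fine (P A).
Proof.
by move=> mA; rewrite /Rintegral integral_indic// setIT.
Qed.

Lemma mean_sum (I : Type) (s : seq I) (F : I -> Omega -> R) :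
  (forall i, bounded_rv (F i)) ->
  \int[P]_w (\sum_(i <- s) F i w) = \sum_(i <- s) \int[P]_w F i w.
Proof.
move=> bF; elim: s => [|i s IH].
  by under eq_Rintegral do rewrite big_nil; rewrite big_nil mean_cst.
under eq_Rintegral do rewrite big_cons.
by rewrite meanD// ?IH ?big_cons//; exact: bounded_rv_sum.
Qed.

Lemma le_mean f g : bounded_rv f -> bounded_rv g -> (forall w, f w <= g w) ->
  \int[P]_w f w <= \int[P]_w g w.
Proof.
by move=> bf bg fg; apply: le_Rintegral => //; exact: bounded_rv_integrable.
Qed.

End bounded.

Section laws_integral.
Context {disp : measure_display} {Omega : measurableType disp} {R : realType}.
Variable P : probability Omega R.

Lemma ge0_integral_law {I : eqType} (V W : I -> {RV P >-> R})
    (F : sequences R I -> \bar R) : iid V -> iid W ->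
  (forall i A, measurable A -> P (V i @^-1` A) = P (W i @^-1` A)) ->
  measurable_fun setT F -> (forall x, (0 <= F x)%E) ->
  (\int[P]_w F (realisation V w) = \int[P]_w F (realisation W w))%E.
Proof.
move=> [Vi _] [Wi _] VW mF F0.
transitivity (\int[distribution P (realisation V)]_x F x)%E.
  by rewrite ge0_integral_distribution.
transitivity (\int[distribution P (realisation W)]_x F x)%E; last first.
  by rewrite ge0_integral_distribution.
by apply: eq_measure_integral => A mA _; exact: (law_unique Vi Wi VW mA).
Qed.

(** Exchangeability: exchanging coordinates with their copies and shifting time
    are both injective relabellings of an i.i.d. family. *)
Lemma ge0_integral_reindex {I J : eqType} (V : I -> {RV P >-> R})
    (a b : J -> I) (F : sequences R J -> \bar R) : iid V ->
  injective a -> injective b ->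
  measurable_fun setT F -> (forall x, (0 <= F x)%E) ->
  (\int[P]_w F (realisation (V \o a) w) =
   \int[P]_w F (realisation (V \o b) w))%E.
Proof.
move=> iV ia ib mF F0; apply: (@ge0_integral_law J (V \o a) (V \o b) F) => //.
- exact: iid_reindex iV.
- exact: iid_reindex iV.
by move=> i A mA; exact: iV.2.
Qed.

Lemma mean_reindex {I J : eqType} (V : I -> {RV P >-> R})
    (a b : J -> I) (F : sequences R J -> R) : iid V ->
  injective a -> injective b -> bounded_rv F ->
  \int[P]_w F (realisation (V \o a) w) =
  \int[P]_w F (realisation (V \o b) w).
Proof.
move=> iV ia ib [mF [c Fc]].
have bF (a' : J -> I) : bounded_rv (fun w => F (realisation (V \o a') w)).
  by split; [apply: measurableT_comp => //; exact: measurable_realisation|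
    exists c].
suff: \int[P]_w (F (realisation (V \o a) w) + c) =
      \int[P]_w (F (realisation (V \o b) w) + c).
  by rewrite !meanD//; [exact: addIr|exact: bounded_rv_cst..].
congr fine.
apply: (@ge0_integral_reindex I J V a b (fun x => (F x + c)%:E)) => //.
  by apply/measurable_EFinP; exact: measurable_funD.
by move=> x; rewrite lee_fin; move: (Fc x); rewrite ler_norml; lra.
Qed.

End laws_integral.

(** * Independence of the two halves of a family *)

Section independent_events.
Context {disp : measure_display} {Omega : measurableType disp} {R : realType}.
Variables (P : probability Omega R) (E : set Omega).
Hypothesis mE : measurable E.

Lemma probability_fin A : measurable A -> P A \is a fin_num.
Proof.
by move=> mA; rewrite ge0_fin_numE// (le_lt_trans (probability_le1 _ _)) ?ltry.
Qed.

Lemma independent_setC F : measurable F ->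
  P (E `&` F) = (P E * P F)%E -> P (E `&` ~` F) = (P E * P (~` F))%E.
Proof.
move=> mF EF; have -> : P (E `&` ~` F) = (P E - P (E `&` F))%E.
  by rewrite -setDE; apply: measureD => //;
    rewrite (le_lt_trans (probability_le1 _ _)) ?ltry.
by rewrite EF probability_setC// muleBr ?mule1// probability_fin.
Qed.

Lemma independent_bigcup (F : (set Omega)^nat) :
  (forall n, measurable (F n)) -> trivIset setT F ->
  (forall n, P (E `&` F n) = (P E * P (F n))%E) ->
  P (E `&` \bigcup_n F n) = (P E * P (\bigcup_n F n))%E.
Proof.
move=> mF tF EF; rewrite setI_bigcupr.
have -> : P (\bigcup_n F n) = (\sum_(n <oo) P (F n))%E.
  by rewrite measure_bigcup//; apply: eq_eseriesl => n; exact: mem_set.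
have -> : P (\bigcup_n (E `&` F n)) = (\sum_(n <oo) P (E `&` F n))%E.
  rewrite measure_bigcup//.
  - by apply: eq_eseriesl => n; exact: mem_set.
  - by move=> n _; exact: measurableI.
  - exact: trivIset_setIl.
rewrite -(fineK (probability_fin mE)) -nneseriesZl//.
by apply: eq_eseriesr => n _; rewrite EF fineK// probability_fin.
Qed.

End independent_events.

Section halves.
Context {disp : measure_display} {Omega : measurableType disp} {R : realType}.
Variables (P : probability Omega R) (I J : eqType).
Variable V : I + J -> {RV P >-> R}.
Hypothesis Vind : mutually_independent V.

Let X := realisation (V \o inl).
Let Y := realisation (V \o inr).

Lemma independent_boxes s A t B :
  (forall i, measurable (A i)) -> (forall j, measurable (B j)) ->
  P (X @^-1` box s A `&` Y @^-1` box t B) =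
  (P (X @^-1` box s A) * P (Y @^-1` box t B))%E.
Proof.
move=> mA mB.
pose u := map inl (undup s) ++ map inr (undup t) : seq (I + J).
have uu : uniq u.
  rewrite cat_uniq !map_inj_uniq ?undup_uniq; [|by move=> ? ? []..].
  by rewrite /= andbT; apply/hasPn => _ /mapP[j _ ->]; apply/mapP => -[].
pose C k := match k with inl i => A i | inr j => B j end.
have mC k : measurable (C k) by case: k.
have half (K : eqType) (a : K -> I + J) r : injective a ->
    P (realisation (V \o a) @^-1` box r (C \o a)) =
    (\prod_(k <- undup r) P (V (a k) @^-1` C (a k)))%E.
  move=> ia; have := @Vind (map a (undup r)) C.
  rewrite map_inj_uniq// undup_uniq big_map => /(_ isT mC) <-.
  congr (P _); apply/seteqP; split=> w /= H.
    by move=> _ /mapP[k kr ->]; apply: H; rewrite -mem_undup.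
  by move=> k kr; apply: (H (a k)) => /=; apply: map_f; rewrite mem_undup.
have := half _ inl s (fun _ _ e => ltac:(by case: e)); rewrite -/X => ->.
have := half _ inr t (fun _ _ e => ltac:(by case: e)); rewrite -/Y => ->.
have := @Vind u C uu mC; rewrite big_cat !big_map => <-.
congr (P _); apply/seteqP; split=> w /=.
  move=> [Xw Yw] k; rewrite /= mem_cat => /orP[] /mapP[l ls ->] /=.
    by apply: Xw; rewrite -mem_undup.
  by apply: Yw; rewrite -mem_undup.
move=> H; split=> k kr.
  by apply: (H (inl k)) => /=; rewrite mem_cat map_f// mem_undup.
by apply: (H (inr k)) => /=; rewrite mem_cat orbC map_f// mem_undup.
Qed.

(** Dynkin's pi-lambda argument in one variable. Independence of two whole
    subfamilies follows by applying it twice, freezing one event at a time. *)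
Lemma independent_of_boxes (K : eqType) (W : K -> {RV P >-> R}) E :
  measurable E ->
  (forall s A, (forall k, measurable (A k)) ->
     P (E `&` realisation W @^-1` box s A) =
     (P E * P (realisation W @^-1` box s A))%E) ->
  forall B : set (sequences R K), measurable B ->
  P (E `&` realisation W @^-1` B) = (P E * P (realisation W @^-1` B))%E.
Proof.
move=> mE EW B; rewrite measurable_sequencesE.
have mW (S : set (sequences R K)) : measurable S ->
    measurable (realisation W @^-1` S).
  exact: measurable_realisation_preimage.
apply: (@dynkin_induction _ (sequences R K) boxes
  (fun S => P (E `&` realisation W @^-1` S) =
            (P E * P (realisation W @^-1` S))%E)).
- exact: measurable_sequencesE.
- exact: boxes_setI.
- by rewrite preimage_setT setIT [X in (_ * X)%E]probability_setT mule1.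
- by move=> _ [s [A [mA ->]]]; exact: EW.
- by move=> S mS ES; rewrite preimage_setC; apply: independent_setC => //; exact: mW.
- move=> F mF tF EF; rewrite preimage_bigcup; apply: independent_bigcup => //.
    by move=> n; exact: mW.
  move=> i j _ _ [w [Fi Fj]]; apply: tF => //.
  by exists (realisation W w).
Qed.

Lemma independent_halves (A : set (sequences R I)) (B : set (sequences R J)) :
  measurable A -> measurable B ->
  P (X @^-1` A `&` Y @^-1` B) = (P (X @^-1` A) * P (Y @^-1` B))%E.
Proof.
move=> mA mB; apply: independent_of_boxes => //.
  exact: measurable_realisation_preimage.
move=> t C mC; rewrite setIC muleC.
apply: independent_of_boxes => //.
  by apply: measurable_realisation_preimage; exact: measurable_box.
by move=> s D mD; rewrite setIC muleC; exact: independent_boxes.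
Qed.

End halves.

Section product_law.
Context {disp : measure_display} {Omega : measurableType disp} {R : realType}.
Variables (P : probability Omega R) (I J : eqType).
Variable V : I + J -> {RV P >-> R}.
Hypothesis Vind : mutually_independent V.

Let X := realisation (V \o inl).
Let Y := realisation (V \o inr).
Let joint w : sequences R I * sequences R J := (X w, Y w).

Let measurable_joint : measurable_fun setT joint.
Proof. by apply: measurable_fun_pair; exact: measurable_realisation. Qed.

HB.instance Definition _ :=
  isMeasurableFun.Build _ _ Omega (sequences R I * sequences R J)%type joint
    measurable_joint.

(** The joint law of the halves is the product of their laws, so that the
    integral of a product factors by Tonelli's theorem. *)
Lemma ge0_mean_independent (U : sequences R I -> R) (W : sequences R J -> R) :
  measurable_fun setT U -> measurable_fun setT W ->
  (forall x, 0 <= U x) -> (forall y, 0 <= W y) ->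
  (\int[P]_w (U (X w) * W (Y w))%:E =
   \int[P]_w (U (X w))%:E * \int[P]_w (W (Y w))%:E)%E.
Proof.
move=> mU mW U0 W0.
have mUW : measurable_fun setT
    (fun z : sequences R I * sequences R J => (U z.1 * W z.2)%:E).
  apply/measurable_EFinP; apply: measurable_funM; exact: measurableT_comp.
pose lX := distribution P (realisation (V \o inl)).
pose lY := distribution P (realisation (V \o inr)).
transitivity (\int[distribution P joint]_z (U z.1 * W z.2)%:E)%E.
  by rewrite ge0_integral_distribution// => z; rewrite lee_fin mulr_ge0.
transitivity (\int[lX \x lY]_z (U z.1 * W z.2)%:E)%E.
  apply: eq_measure_integral => A mA _.
  apply/esym.
  apply: (@product_measure_unique _ _ _ _ R lX lY (distribution P joint)) => //.
  move=> B C mB mC.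
  exact: (independent_halves Vind mB mC).
rewrite fubini_tonelli1//; last by move=> z; rewrite lee_fin mulr_ge0.
have mUE : measurable_fun setT (EFin \o U) by exact/measurable_EFinP.
have mWE : measurable_fun setT (EFin \o W) by exact/measurable_EFinP.
transitivity (\int[lX]_x ((U x)%:E * \int[lY]_y (W y)%:E))%E.
  apply: eq_integral => x _; rewrite /fubini_F /=.
  under eq_integral do rewrite EFinM.
  by rewrite ge0_integralZl// => [y _|]; rewrite lee_fin.
rewrite ge0_integralZr//; last 2 first.
  by move=> x _; rewrite lee_fin.
  by apply: integral_ge0 => y _; rewrite lee_fin.
by rewrite !ge0_integral_distribution// => z; rewrite lee_fin.
Qed.

(** Adding constants to the two factors reduces the bounded case to the
    nonnegative one; the cross terms cancel on both sides. *)
Lemma mean_independent (U : sequences R I -> R) (W : sequences R J -> R) :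
  bounded_rv U -> bounded_rv W ->
  \int[P]_w (U (X w) * W (Y w)) =
  (\int[P]_w U (X w)) * \int[P]_w W (Y w).
Proof.
move=> [mU [c Uc]] [mW [d Wd]].
have bU : bounded_rv (fun w => U (X w)).
  by split; [apply: measurableT_comp => //; exact: measurable_realisation|exists c].
have bW : bounded_rv (fun w => W (Y w)).
  by split; [apply: measurableT_comp => //; exact: measurable_realisation|exists d].
have bcst a : bounded_rv (fun _ : Omega => a) by exact: bounded_rv_cst.
have bUc : bounded_rv (fun w => U (X w) + c) by exact: bounded_rvD.
have bWd : bounded_rv (fun w => W (Y w) + d) by exact: bounded_rvD.
have : \int[P]_w ((U (X w) + c) * (W (Y w) + d)) =
    (\int[P]_w (U (X w) + c)) * \int[P]_w (W (Y w) + d).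
  rewrite /Rintegral -fineM; last 2 first.
    by apply: integrable_fin_num => //; exact: bounded_rv_integrable.
    by apply: integrable_fin_num => //; exact: bounded_rv_integrable.
  congr fine.
  apply: (@ge0_mean_independent (fun x => U x + c) (fun y => W y + d)).
  - exact: measurable_funD.
  - exact: measurable_funD.
  - by move=> x; move: (Uc x); rewrite ler_norml; lra.
  - by move=> y; move: (Wd y); rewrite ler_norml; lra.
have -> : \int[P]_w ((U (X w) + c) * (W (Y w) + d)) =
  \int[P]_w (U (X w) * W (Y w)) + d * \int[P]_w U (X w) +
  c * \int[P]_w W (Y w) + c * d.
  rewrite -!meanZ// -[X in _ + X](mean_cst P) -!meanD//; try by
    do ?[exact: bounded_rvM|apply: bounded_rvD => //].
  by apply: eq_Rintegral => w _; ring.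
rewrite !meanD// !mean_cst => ?; lra.
Qed.

End product_law.

(** * Replacing the recent coordinates by an independent copy *)

(** In a family indexed by [nat + nat], the indices [inl i] stand for a sequence
    and the indices [inr i] for an independent copy of it. Reading the family
    along [splice N] gives the sequence with its first [N] coordinates taken from
    the copy; along [resample k], with only the coordinate [k] taken from it. *)
Definition splice (N i : nat) : nat + nat := if (i < N)%N then inr i else inl i.

Definition resample (k i : nat) : nat + nat := if i == k then inr i else inl i.

Lemma splice_inj N : injective (splice N).
Proof. by move=> i j; rewrite /splice; do 2 case: ifP => _; case. Qed.

Lemma resample_inj k : injective (resample k).
Proof. by move=> i j; rewrite /resample; do 2 case: ifP => _; case. Qed.

Section resampling.
Context {disp : measure_display} {Omega : measurableType disp} {R : realType}.
Variables (P : probability Omega R) (V : nat + nat -> {RV P >-> R}).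
Hypothesis iV : iid V.

Let X a := realisation (V \o a) : Omega -> sequences R nat.

Let differ N (B : set (sequences R nat)) : set Omega :=
  [set w | B (X (splice N) w) <> B (X inr w)].

Let PX a b (B : set (sequences R nat)) : injective a -> injective b ->
  measurable B -> P (X a @^-1` B) = P (X b @^-1` B).
Proof.
move=> ia ib mB.
have [Va Vai] := iid_reindex ia iV; have [Vb Vbi] := iid_reindex ib iV.
by apply: law_unique => // i A mA; exact: iV.2.
Qed.

Let mX a B : measurable B -> measurable (X a @^-1` B).
Proof. exact: measurable_realisation_preimage. Qed.

Let differE N B : differ N B =
  (X (splice N) @^-1` B `\` X inr @^-1` B) `|`
  (X inr @^-1` B `\` X (splice N) @^-1` B).
Proof.
apply/seteqP; split=> w /=.
  have [h1|h1] := pselect (B (X (splice N) w));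
    have [h2|h2] := pselect (B (X inr w)); rewrite /differ/=.
  - by case; rewrite !propeqE.
  - by move=> _; left.
  - by move=> _; right.
  - by case; rewrite propeqE.
by case=> [[h1 h2]|[h1 h2]] e; move: h1 h2; rewrite e.
Qed.

Let measurable_differ N B : measurable B -> measurable (differ N B).
Proof.
by move=> mB; rewrite differE; apply: measurableU; apply: measurableD; exact: mX.
Qed.

(** The spliced sequence still depends on the original one through infinitely
    many coordinates; this property says that in the limit membership in [B]
    does not see them. That it holds for every measurable [B] plays the part of
    Kolmogorov's zero-one law. *)
Definition splice_forgets (B : set (sequences R nat)) : Prop :=
  measurable B /\ forall eta : R, 0 < eta ->
    \forall N \near \oo, (P (differ N B) <= eta%:E)%E.

Let ta_box s A : (forall i, measurable (A i)) -> splice_forgets (box s A).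
Proof.
move=> mA; split; first exact: measurable_box.
move=> eta eta0; exists (\max_(i <- s) i.+1)%N => // N /= sN.
rewrite (_ : differ _ _ = set0) ?measure0 ?lee_fin ?(ltW eta0)//.
apply/seteqP; split=> // w /=; apply; rewrite propeqE.
have XE i : i \in s -> X (splice N) w i = X inr w i.
  move=> si; rewrite /X /realisation /= /splice ifT//.
  by rewrite (leq_trans _ sN)// -[(i < _)%N]/(i.+1 <= _)%N; exact: leq_bigmax_seq.
by split=> H i si; [rewrite -XE //|rewrite XE //]; exact: H.
Qed.

Let taC B : splice_forgets B -> splice_forgets (~` B).
Proof.
move=> [mB taB]; split; first exact: measurableC.
move=> eta /taB; apply: filterS => N; apply: le_trans.
apply: le_measure; rewrite ?inE; [exact/measurable_differ/measurableC|
  exact: measurable_differ|].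
by move=> w /=; apply: contra_not; rewrite /setC/= => ->.
Qed.

Let taU A B : splice_forgets A -> splice_forgets B ->
  splice_forgets (A `|` B).
Proof.
move=> [mA taA] [mB taB]; split; first exact: measurableU.
move=> eta eta0; have e2 : 0 < eta / 2 by rewrite divr_gt0.
near=> N; apply: (@le_trans _ _ (P (differ N A `|` differ N B))).
  apply: le_measure; rewrite ?inE.
  - exact/measurable_differ/measurableU.
  - by apply: measurableU; exact: measurable_differ.
  - move=> w /=; apply: contraPP => /not_orP[/contrapT eA /contrapT eB] /=.
    by apply; rewrite /setU/= eA eB.
apply: (le_trans (measureU2 _ _ _)); [exact: measurable_differ..|].
rewrite (splitr eta) EFinD; apply: leeD.
  by near: N; exact: taA.
by near: N; exact: taB.
Unshelve. all: by end_near. Qed.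

Let ta_bigcup (F : (set (sequences R nat))^nat) :
  (forall n, splice_forgets (F n)) -> splice_forgets (\bigcup_n F n).
Proof.
move=> taF; have mF n : measurable (F n) by case: (taF n).
have mUF : measurable (\bigcup_n F n) by exact: bigcupT_measurable.
split=> // eta eta0.
pose U n := \big[setU/set0]_(i < n) F i.
have taUn n : splice_forgets (U n).
  elim: n => [|n IH]; rewrite /U.
    rewrite big_ord0 (_ : set0 = ~` box [::] (fun=> setT)).
      by apply: taC; exact: ta_box.
    by apply/esym/seteqP; split=> // x; apply.
  by rewrite big_ord_recr; exact: taU.
have mU n : measurable (U n) by case: (taUn n).
pose rest n := \bigcup_n F n `\` U n.
have mrest n : measurable (rest n) by exact: measurableD.
have e3 : 0 < eta / 3 by rewrite divr_gt0.
(* The remainders decrease to the empty set, and their probability under the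
   spliced sequence is the same as under the copy, uniformly in [N]. *)
have [n Pn] : exists n, (P (X inr @^-1` rest n) <= (eta / 3)%:E)%E.
  have : (fun n => P (X inr @^-1` rest n)) @ \oo --> P (\bigcap_n (X inr @^-1` rest n)).
    apply: nonincreasing_cvg_mu.
    - by rewrite (le_lt_trans (probability_le1 _ _)) ?ltry//; exact: mX.
    - by move=> n; exact: mX.
    - by apply: bigcapT_measurable => n; exact: mX.
    - move=> m n mn; apply/subsetPset => w [Fw Uw]; split=> // Umw; apply: Uw.
      by apply: subset_bigsetU Umw.
  rewrite (_ : \bigcap_n _ = set0) ?measure0; last first.
    apply/seteqP; split=> // w H; have [[k _ Fk] _] := H 0%N I.
    have [_] := H k.+1 I; apply; rewrite /U -bigcup_mkord.
    by exists k => //=; rewrite ltnSn.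
  move=> /fine_cvgP[_ /cvgrPdist_lt /(_ _ e3)[n _ /(_ n (leqnn _))]] /=.
  rewrite sub0r normrN => H; exists n.
  rewrite -(@fineK _ (P _)) ?probability_fin//; last exact: mX.
  by rewrite lee_fin ltW// (le_lt_trans (ler_norm _)).
near=> N.
apply: (@le_trans _ _ (P (differ N (U n) `|`
    (X (splice N) @^-1` rest n `|` X inr @^-1` rest n)))).
  apply: le_measure; rewrite ?inE.
  - exact: measurable_differ.
  - apply: measurableU; first exact: measurable_differ.
    by apply: measurableU; exact: mX.
  - move=> w; apply: contraPP => /not_orP[/contrapT eU /not_orP[h1 h2]]; apply.
    have UF x : U n x -> (\bigcup_n F n) x.
      by rewrite /U -bigcup_mkord => -[k _ Fk]; exists k.
    have FU a : ~ rest n (X a w) -> (\bigcup_n F n) (X a w) = U n (X a w).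
      move=> h; rewrite propeqE; split; last exact: UF.
      by move=> Fa; apply: contrapT => Ua; apply: h.
    by rewrite !FU.
apply: (le_trans (measureU2 _ _ _)).
- exact: measurable_differ.
- by apply: measurableU; exact: mX.
rewrite (_ : eta = eta / 3 + (eta / 3 + eta / 3)); last by field.
rewrite EFinD; apply: leeD.
  by near: N; apply: (taUn n).2.
apply: (le_trans (measureU2 _ _ _)); [exact: mX..|].
rewrite EFinD; apply: leeD => //.
move: Pn; have -> : P (X inr @^-1` rest n) = P (X (splice N) @^-1` rest n).
  by apply: PX => //; [move=> i j []|exact: splice_inj].
by apply.
Unshelve. all: by end_near. Qed.

(** Boxes are eventually insensitive to splicing, and the property is stable
    under the operations of a sigma-algebra. *)
Lemma measurable_splice_forgets (B : set (sequences R nat)) :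
  measurable B -> splice_forgets B.
Proof.
rewrite measurable_sequencesE => mB.
have : sigma_algebra setT splice_forgets.
  split.
  - rewrite (_ : set0 = ~` box [::] (fun=> setT)).
      by apply: taC; exact: ta_box.
    by apply/esym/seteqP; split=> // x; apply.
  - by move=> A taA; rewrite setTD; exact: taC.
  - by move=> F taF; exact: ta_bigcup.
move=> sa; apply: (smallest_sub sa _ mB) => _ [s [A [mA ->]]].
exact: ta_box.
Qed.

(** Cutting the range of [f] by a finite grid of mesh [h = eta / 2], the two
    values of [f] differ by more than [h] only if some level set of the grid
    contains exactly one of the two sequences; there are finitely many level
    sets and each of them forgets. *)
Lemma splice_mean_cvg (f : sequences R nat -> R) eta : bounded_rv f -> 0 < eta ->
  \forall N \near \oo, \int[P]_w `|f (X (splice N) w) - f (X inr w)| <= eta.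
Proof.
move=> [mf [c fc]] eta0.
have c0 : 0 <= c by exact: le_trans (fc (fun=> 0)).
pose h := eta / 2.
have h0 : 0 < h by rewrite divr_gt0.
have [J Jc] : exists J : nat, 2 * c / h < J%:R.
  exists (Num.truncn (2 * c / h)).+1; exact: truncnS_gt.
pose B (j : 'I_J.+1) : set (sequences R nat) := f @^-1` `[- c + j%:R * h, +oo[.
have mB j : measurable (B j) by rewrite -[B j]setTI; exact: mf.
pose k := 2 * c * J.+1%:R + 1.
have k0 : 0 < k by rewrite ltr_pwDr// mulr_ge0// mulr_ge0.
have e0 : 0 < h / k by rewrite divr_gt0.
have key a b : `|a| <= c -> `|b| <= c ->
    (forall j : 'I_J.+1, (- c + j%:R * h <= a) = (- c + j%:R * h <= b)) ->
    `|a - b| <= h.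
  wlog : a b / b <= a.
    move=> H ac bc ab; have [/H|/ltW /H] := leP b a; first exact.
    by rewrite distrC; apply=> // j; rewrite ab.
  move=> ba; rewrite !ler_norml => /andP[ac1 ac2] /andP[bc1 bc2] H.
  rewrite -ler_norml ger0_norm ?subr_ge0// leNgt; apply/negP => hab.
  have bh : 0 <= (b + c) / h by rewrite divr_ge0 ?(ltW h0)//; lra.
  pose j := (Num.truncn ((b + c) / h)).+1.
  have bj : (b + c) / h < j%:R by exact: truncnS_gt.
  have jb : j%:R - 1 <= (b + c) / h.
    by rewrite /j -natr1 addrK truncn_le.
  move: bj jb; rewrite ltr_pdivrMr// ler_pdivlMr// => bj jb.
  have ja : - c + j%:R * h <= a by lra.
  have jJ : (j < J.+1)%N.
    rewrite ltnS -(ler_nat R) -(ler_pM2r h0).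
    by move: Jc; rewrite ltr_pdivrMr//; lra.
  by have := H (Ordinal jJ); rewrite /= ja => /esym; lra.
have bX a : bounded_rv (fun w => f (X a w)).
  split; last by exists c.
  by apply: measurableT_comp => //; exact: measurable_realisation.
have bD N : bounded_rv (fun w => `|f (X (splice N) w) - f (X inr w)|).
  exact: bounded_rv_norm (bounded_rvB (bX _) (bX _)).
have : \forall N \near \oo, forall j, (P (differ N (B j)) <= (h / k)%:E)%E.
  by apply: filter_forall => j; apply: (measurable_splice_forgets (mB j)).2.
apply: filterS => N HN.
pose D j := differ N (B j).
have mD j : measurable (D j) by exact: measurable_differ.
apply: (@le_trans _ _ (\int[P]_w (h + 2 * c * \sum_j \1_(D j) w))).
  apply: le_mean.
  - exact: bD.
  - apply: bounded_rvD; first exact: bounded_rv_cst.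
    apply: bounded_rvM; first exact: bounded_rv_cst.
    by apply: bounded_rv_sum => j; exact: bounded_rv_indic.
  - move=> w; have S0 : 0 <= \sum_j (\1_(D j) w : R).
      by apply: sumr_ge0 => j _; rewrite indicE.
    have [[j Dj]|nD] := pselect (exists j, D j w).
      have S1 : 1 <= \sum_j (\1_(D j) w : R).
        rewrite (bigD1 j)//= indicE mem_set//= lerDl.
        by apply: sumr_ge0 => i _; rewrite indicE.
      apply: (@le_trans _ _ (2 * c)); last by nra.
      by rewrite (le_trans (ler_normB _ _))// mulr_natl mulr2n lerD.
    apply: (@le_trans _ _ h); last by rewrite lerDl !mulr_ge0.
    apply: key => // j.
    have : B j (X (splice N) w) = B j (X inr w).
      by apply: contrapT => e; apply: nD; exists j.
    by rewrite /B /= !in_itv/= !andbT => e; apply/idP/idP; rewrite e.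
rewrite meanD ?mean_cst; last 2 first.
- exact: bounded_rv_cst.
- apply: bounded_rvM; first exact: bounded_rv_cst.
  by apply: bounded_rv_sum => j; exact: bounded_rv_indic.
rewrite meanZ; last by apply: bounded_rv_sum => j; exact: bounded_rv_indic.
rewrite mean_sum; last by move=> j; exact: bounded_rv_indic.
have : \sum_j \int[P]_w \1_(D j) w <= \sum_(j < J.+1) (h / k).
  apply: ler_sum => j _; rewrite mean_indic//.
  by rewrite -lee_fin fineK ?probability_fin//; exact: HN.
rewrite sumr_const card_ord -[_ *+ _]mulr_natr => S.
have : 2 * c * \sum_j \int[P]_w \1_(D j) w <= h.
  apply: (@le_trans _ _ (2 * c * (h / k * J.+1%:R))).
    by apply: ler_wpM2l => //; rewrite mulr_ge0.
  have -> : 2 * c * (h / k * J.+1%:R) = h * (2 * c * J.+1%:R / k) by ring.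
  by rewrite ler_piMr ?(ltW h0)// ler_pdivrMr// mul1r lerDl.
rewrite /h; lra.
Qed.

End resampling.

(** * An Efron-Stein inequality in [L^p] for bounded functions *)

Section efron_stein.
Context {disp : measure_display} {Omega : measurableType disp} {R : realType}.
Variables (P : probability Omega R) (V : nat + nat -> {RV P >-> R}).
Hypothesis iV : iid V.

Let X a := realisation (V \o a) : Omega -> sequences R nat.

(** Exchanging the original and the copied coordinate [k] turns [inl] into
    [resample k] and interchanges [splice k] with [splice k.+1]. *)
Definition swap_at k (i : nat + nat) : nat + nat :=
  match i with
  | inl j => resample k j
  | inr j => if j == k then inl j else inr j
  end.

(** Exchanging all coordinates below [k] turns the pair [inl], [resample k] into
    the pair [splice k], [splice k.+1]. *)
Definition swap_below k (i : nat + nat) : nat + nat :=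
  match i with
  | inl j => splice k j
  | inr j => if (j < k)%N then inl j else inr j
  end.

Lemma swap_at_inj k : injective (swap_at k).
Proof.
by move=> [i|i] [j|j]; rewrite /swap_at /resample;
  case: (i =P k) => [->|ik]; case: (j =P k) => [->|jk] //= [] // e;
  congruence.
Qed.

Lemma swap_below_inj k : injective (swap_below k).
Proof.
by move=> [i|i] [j|j]; rewrite /swap_below /splice;
  case: ifP => hi; case: ifP => hj e; congruence.
Qed.

Lemma swap_at_splice k : swap_at k \o splice k = splice k.+1.
Proof.
apply/funext => i /=; rewrite /splice ltnS /swap_at /resample.
by case: (ltngtP i k) => [ik|ik|->] /=; rewrite ?eqxx ?(ltn_eqF ik) ?(gtn_eqF ik).
Qed.

Lemma swap_at_spliceS k : swap_at k \o splice k.+1 = splice k.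
Proof.
apply/funext => i /=; rewrite /splice ltnS /swap_at /resample.
by case: (ltngtP i k) => [ik|ik|->] /=; rewrite ?eqxx ?(ltn_eqF ik) ?(gtn_eqF ik).
Qed.

Lemma swap_below_resample k : swap_below k \o resample k = splice k.+1.
Proof.
apply/funext => i /=; rewrite /splice ltnS /resample.
by case: (ltngtP i k) => // ik /=; rewrite /splice ?ik ?ltnn// ltnNge ltnW.
Qed.

Variables (f : sequences R nat -> R) (p W : R) (alpha : nat -> R).
Hypotheses (p2 : 2 < p) (bf : bounded_rv f).
Hypothesis alpha0 : forall k, 0 < alpha k.
Hypothesis resampling_bound : forall k,
  \int[P]_w `|f (X inl w) - f (X (resample k) w)| `^ p <= alpha k `^ p.
Hypothesis alphaW : forall N, \sum_(k < N) alpha k ^+ 2 <= W.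

(** The factor 3 comes from [mul3_le_powR] and the other one from
    [signed_power_lipschitz], with the least integer above [p - 2]. *)
Definition moment_constant : R := 3 * (Num.truncn (p - 2)).+2%:R.

Let M : R := \int[P]_w f (X inl w).
Let g x := f x - M.
Let phi x := signed_power p (g x).
Let F : R := \int[P]_w `|g (X inl w)| `^ p.

Let bg : bounded_rv g.
Proof. by apply: bounded_rvB => //; exact: bounded_rv_cst. Qed.

Let p20 : 0 <= p - 2. Proof. by rewrite subr_ge0 ltW. Qed.
Let p0 : 0 <= p. Proof. by rewrite (le_trans _ (ltW p2)). Qed.

Let bphi : bounded_rv phi.
Proof. by apply: bounded_rvM => //; exact: bounded_rv_powR. Qed.

Let bX (h : sequences R nat -> R) a : bounded_rv h ->
  bounded_rv (fun w => h (X a w)).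
Proof.
move=> [mh [c hc]]; split; last by exists c.
by apply: measurableT_comp => //; exact: measurable_realisation.
Qed.

Let bZ (h : sequences R nat -> R) (a : nat -> nat + nat) : bounded_rv h ->
  bounded_rv (fun z : sequences R (nat + nat)%type => h (z \o a)).
Proof.
move=> [mh [c hc]]; split; last by exists c.
exact: (measurableT_comp mh (measurable_reindex a)).
Qed.

Let inlI : injective (inl : nat -> nat + nat). Proof. by move=> ? ? []. Qed.
Let inrI : injective (inr : nat -> nat + nat). Proof. by move=> ? ? []. Qed.

Let splice_increment k :
  \int[P]_w `|f (X (splice k) w) - f (X (splice k.+1) w)| `^ p <= alpha k `^ p.
Proof.
apply: le_trans (resampling_bound k); rewrite le_eqVlt; apply/orP; left; apply/eqP.
apply/esym.
rewrite -swap_below_resample.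
apply: (@mean_reindex _ _ _ P _ _ V id (swap_below k)
  (fun z => `|f (z \o inl) - f (z \o resample k)| `^ p)) => //.
  exact: swap_below_inj.
by apply: bounded_rv_powR => //; apply: bounded_rvB; exact: bZ.
Qed.

Let norm_resample a : injective a -> \int[P]_w `|g (X a w)| `^ p = F.
Proof.
move=> ia; apply: (@mean_reindex _ _ _ P _ _ V a inl
  (fun x => `|g x| `^ p)) => //.
exact: bounded_rv_powR.
Qed.

Let step k := \int[P]_w (phi (X inl w) * (f (X (splice k) w) - f (X (splice k.+1) w))).

(* Swapping the two coordinates [k] changes the sign of the increment of [f]
   without changing the law, hence the symmetrised form. *)
Let step_sym k : step k = \int[P]_w (2^-1 * ((phi (X inl w) - phi (X (resample k) w)) *
  (f (X (splice k) w) - f (X (splice k.+1) w)))).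
Proof.
have bstep a b c : bounded_rv (fun w => phi (X a w) * (f (X b w) - f (X c w))).
  by apply: bounded_rvM; [exact: bX|apply: bounded_rvB; exact: bX].
have E : step k =
    \int[P]_w (phi (X (resample k) w) * (f (X (splice k.+1) w) - f (X (splice k) w))).
  transitivity (\int[P]_w (phi (X (resample k) w) *
      (f (X (swap_at k \o splice k) w) - f (X (swap_at k \o splice k.+1) w)))).
    2: by rewrite swap_at_splice swap_at_spliceS.
  apply: (@mean_reindex _ _ _ P _ _ V id (swap_at k)
    (fun z => phi (z \o inl) * (f (z \o splice k) - f (z \o splice k.+1)))) => //.
    exact: swap_at_inj.
  by apply: bounded_rvM; [exact: bZ|apply: bounded_rvB; exact: bZ].
have -> : step k = 2^-1 * (step k + step k) by field.
rewrite {2}E -meanD// -meanZ; last exact: bounded_rvD.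
by apply: eq_Rintegral => w _; ring.
Qed.

Let step_bound k (B : R) : 0 < B -> F = B `^ p ->
  step k <= moment_constant * alpha k ^+ 2 * B `^ (p - 2).
Proof.
move=> B0 FB; rewrite step_sym.
set n := (Num.truncn (p - 2)).+1.
have pn : p - 2 <= n%:R by rewrite ltW// truncnS_gt.
pose u w := `|g (X inl w) - g (X (resample k) w)|.
pose v w := `|f (X (splice k) w) - f (X (splice k.+1) w)|.
pose s a w := `|g (X a w)|.
pose A := alpha k.
pose K := A ^+ 2 * B `^ (p - 2).
pose T a w := A^-1 `^ p * u w `^ p + A^-1 `^ p * v w `^ p + B^-1 `^ p * s a w `^ p.
have K0 : 0 <= K by rewrite mulr_ge0 ?sqr_ge0 ?powR_ge0.
have bu : bounded_rv (fun w => u w `^ p).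
  by apply: bounded_rv_powR => //; apply: bounded_rvB; exact: bX.
have bv : bounded_rv (fun w => v w `^ p).
  by apply: bounded_rv_powR => //; apply: bounded_rvB; exact: bX.
have bs a : bounded_rv (fun w => s a w `^ p).
  by apply: bounded_rv_powR => //; exact: bX.
have bc c h : bounded_rv h -> bounded_rv (fun w : Omega => c * h w).
  by move=> bh; apply: bounded_rvM => //; exact: bounded_rv_cst.
have bT a : bounded_rv (T a).
  by apply: bounded_rvD; [apply: bounded_rvD|]; exact: bc.
have ET a : injective a -> \int[P]_w T a w <= 3.
  move=> ia; rewrite /T !meanD ?meanZ//; try exact: bc; last first.
    by apply: bounded_rvD; exact: bc.
  have EA (q : R) : q <= A `^ p -> A^-1 `^ p * q <= 1.
    move=> qA; apply: (le_trans (ler_wpM2l (powR_ge0 _ _) qA)).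
    have A0 := alpha0 k.
    have Ai : 0 <= A^-1 by rewrite invr_ge0 ltW.
    by rewrite -powRM// ?(ltW A0)// mulVf ?gt_eqF// powR1.
  have Eu : \int[P]_w (u w `^ p) <= A `^ p.
    apply: le_trans (resampling_bound k); rewrite le_eqVlt; apply/orP; left.
    by apply/eqP; apply: eq_Rintegral => w _; rewrite /u /g opprB addrA subrK.
  have Es : B^-1 `^ p * \int[P]_w (s a w `^ p) = 1.
    rewrite [X in _ * X](norm_resample ia) FB.
    have Bi : 0 <= B^-1 by rewrite invr_ge0 ltW.
    by rewrite -powRM// ?(ltW B0)// mulVf ?gt_eqF// powR1.
  have Ev : \int[P]_w (v w `^ p) <= A `^ p by exact: splice_increment.
  rewrite Es; apply: (@le_trans _ _ (1 + 1 + 1)).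
    by rewrite !lerD// EA.
  lra.
apply: (@le_trans _ _ (\int[P]_w (2^-1 * n.+1%:R * K * (T inl w + T (resample k) w)))).
  apply: le_mean.
  - apply: bc; apply: bounded_rvM; apply: bounded_rvB; exact: bX.
  - by apply: bc; exact: bounded_rvD.
  - move=> w; rewrite -!mulrA ler_wpM2l//; apply: (le_trans (ler_norm _)).
    rewrite normrM -/(v w).
    have := signed_power_lipschitz (g (X inl w)) (g (X (resample k) w)) p2 pn.
    move=> /(ler_wpM2r (normr_ge0 (f (X (splice k) w) - f (X (splice k.+1) w)))).
    move=> /le_trans; apply; rewrite -mulrA ler_wpM2l// -/(u w) -/(v w).
    rewrite mulrDr; rewrite -/(s inl w) -/(s (resample k) w).
    have H a : u w * (v w * s a w `^ (p - 2)) <= K * T a w.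
      by apply: mul3_le_powR => //; [exact: alpha0|exact: normr_ge0..].
    have := H inl; have := H (resample k).
    move: (T inl w) (T (resample k) w) (u w) (v w) (s inl w `^ (p - 2))
      (s (resample k) w `^ (p - 2)).
    by move=> t1 t2 x1 x2 x3 x4; rewrite /K; lra.
rewrite meanZ; last exact: bounded_rvD.
rewrite meanD//.
apply: (@le_trans _ _ (2^-1 * n.+1%:R * K * (3 + 3))).
  apply: ler_wpM2l; first by apply: mulr_ge0 => //; apply: mulr_ge0.
  by apply: lerD; apply: ET => //; exact: resample_inj.
by rewrite /moment_constant -/n /K /A; lra.
Qed.

(* The far past is replaced by the copy in the limit, and the copy is
   independent of [X inl] with [g] of mean zero. *)
Let remainder_small eta : 0 < eta -> exists N,
  \int[P]_w (phi (X inl w) * g (X (splice N) w)) <= eta.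
Proof.
move=> eta0; have [_ [c phic]] := bphi.
have c0 : 0 <= c by exact: le_trans (phic (fun=> 0)).
have [N _ /(_ N (leqnn N)) /= HN] :=
  splice_mean_cvg iV bf (divr_gt0 eta0 (ltr_pwDr ltr01 c0)).
exists N.
have b1 a : bounded_rv (fun w => phi (X inl w) * g (X a w)).
  by apply: bounded_rvM; exact: bX.
have bd : bounded_rv (fun w => `|f (X (splice N) w) - f (X inr w)|).
  by apply: bounded_rv_norm; apply: bounded_rvB; exact: bX.
have Eg : \int[P]_w g (X inr w) = 0.
  rewrite (@mean_reindex _ _ _ P _ _ V inr inl g)//.
  rewrite meanB; [|exact: bX|exact: bounded_rv_cst].
  by rewrite mean_cst subrr.
have E0 : \int[P]_w (phi (X inl w) * g (X inr w)) = 0.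
  have [Vi _] := iV.
  have := @mean_independent _ _ _ P nat nat V Vi phi g bphi bg.
  by rewrite Eg mulr0.
rewrite -[leLHS]subr0 -[X in _ - X]E0 -meanB//.
apply: (@le_trans _ _ (\int[P]_w (c * `|f (X (splice N) w) - f (X inr w)|))).
  apply: le_mean; first exact: bounded_rvB.
    by apply: bounded_rvM => //; exact: bounded_rv_cst.
  move=> w; rewrite -mulrBr (le_trans (ler_norm _))// normrM.
  by rewrite /g opprB addrA subrK ler_wpM2r.
rewrite meanZ//; apply: (le_trans (ler_wpM2l c0 HN)).
rewrite mulrCA ler_piMr ?(ltW eta0)// ler_pdivrMr ?mul1r ?lerDl//.
exact: ltr_pwDr.
Qed.

(** The moment [F] is the mean of [phi (X inl) * g (X inl)]. Replacing the second
    argument by the spliced sequences one coordinate at a time expresses it, up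
    to a vanishing remainder, as a telescoping sum of the terms [step k], and
    each of them is at most a multiple of [alpha k ^+ 2 * F `^ (1 - 2 / p)].
    Dividing by the power of [F] gives the claim: squares of the resampling
    bounds are summed, not the bounds themselves, just as for martingales. *)
Lemma bounded_moment_inequality : F <= (moment_constant * W) `^ (p / 2).
Proof.
have F0 : 0 <= F by apply: Rintegral_ge0 => w _; exact: powR_ge0.
have [->|Fn0] := eqVneq F 0; first exact: powR_ge0.
have pn0 : p != 0 by rewrite gt_eqF// (lt_trans _ p2).
(* The [L^p] norm of the centred variable. *)
have [B B0 FB] : exists2 B, 0 < B & F = B `^ p.
  exists (F `^ (p^-1)); first by rewrite powR_gt0// lt0r Fn0.
  by rewrite -powRrM mulVf// powRr1.
have K0 : 0 <= moment_constant by rewrite mulr_ge0.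
have FE N : F = \sum_(k < N) step k + \int[P]_w (phi (X inl w) * g (X (splice N) w)).
  elim: N => [|N IH].
    rewrite big_ord0 add0r; apply: eq_Rintegral => w _.
    by rewrite -mul_signed_power// (_ : splice 0 = inl).
  rewrite {}IH big_ord_recr/= -addrA; congr (_ + _).
  rewrite -meanD; last 2 first.
  - by apply: bounded_rvM; [exact: bX|apply: bounded_rvB; exact: bX].
  - by apply: bounded_rvM; exact: bX.
  by apply: eq_Rintegral => w _; rewrite /g; ring.
have FW : F <= moment_constant * W * B `^ (p - 2).
  apply/ler_addgt0Pr => eta /remainder_small[N HN]; rewrite {1}(FE N) lerD//.
  apply: (@le_trans _ _ (\sum_(k < N) moment_constant * alpha k ^+ 2 * B `^ (p - 2))).
    by apply: ler_sum => k _; exact: step_bound.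
  rewrite -mulr_suml -mulr_sumr ler_wpM2r ?powR_ge0// ler_wpM2l//.
have B2 : B ^+ 2 <= moment_constant * W.
  have BE : B `^ p = B ^+ 2 * B `^ (p - 2).
    have := mul_signed_power B p2; rewrite /signed_power (ger0_norm (ltW B0)) => <-.
    by rewrite mulrAC -expr2.
  by move: FW; rewrite FB BE ler_pM2r// powR_gt0.
have MW0 : 0 <= moment_constant * W by exact: le_trans (sqr_ge0 B) B2.
have -> : F = (B ^+ 2) `^ (p / 2).
  by rewrite -powR_mulrn ?(ltW B0)// -powRrM mulrC divfK.
have p20' : 0 <= p / 2 by move: p0; lra.
by apply: ge0_ler_powR => //; rewrite nnegrE sqr_ge0.
Qed.

End efron_stein.

(** * The Efron-Stein inequality in [L^p] for integrable functions *)

Section clamp.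
Context {R : realType}.
Implicit Types c x y : R.

(** Clamping is a contraction, so it preserves the resampling bounds while
    making a function bounded. *)
Definition clamp c x : R := Num.max (- c) (Num.min c x).

Variant clamp_spec c x : R -> Prop :=
  | ClampLow of x <= - c : clamp_spec c x (- c)
  | ClampHigh of c <= x : clamp_spec c x c
  | ClampMid of - c <= x & x <= c : clamp_spec c x x.

Lemma clampP c x : 0 <= c -> clamp_spec c x (clamp c x).
Proof.
move=> c0; rewrite /clamp minEle maxEle.
have [cx|xc] := leP c x; first by rewrite (le_trans _ c0) ?oppr_le0//; constructor.
have [cx|xc'] := leP (- c) x; constructor => //; exact: ltW.
Qed.

Lemma norm_clamp c x : 0 <= c -> `|clamp c x| <= c.
Proof. by move=> c0; rewrite ler_norml; case: clampP => // *; lra. Qed.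

Lemma clamp_le_norm c x : 0 <= c -> `|clamp c x| <= `|x|.
Proof.
move=> c0; have [x0|x0] := leP 0 x;
  rewrite ?(ger0_norm x0) ?(ltr0_norm x0) ler_norml; case: clampP => // *; lra.
Qed.

Lemma clamp_contraction c x y : 0 <= c -> `|clamp c x - clamp c y| <= `|x - y|.
Proof.
move=> c0; wlog : x y / y <= x.
  move=> H; have [/H//|/ltW /H] := leP y x.
  by rewrite distrC (distrC x).
move=> yx; rewrite (@ger0_norm _ (x - y)) ?subr_ge0// ler_norml.
by case: (clampP x) => // *; case: clampP => // *; lra.
Qed.

Lemma clamp_id c x : `|x| <= c -> clamp c x = x.
Proof.
move=> xc; have c0 : 0 <= c by exact: le_trans xc.
by move: xc; rewrite ler_norml; case: clampP => // *; lra.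
Qed.

Lemma measurable_clamp c : measurable_fun setT (clamp c).
Proof.
by apply: measurable_maxr; [exact: measurable_cst|
  apply: measurable_minr; [exact: measurable_cst|exact: measurable_id]].
Qed.

End clamp.

Section moment_inequality.
Context {disp : measure_display} {Omega : measurableType disp} {R : realType}.
Variables (P : probability Omega R) (V : nat + nat -> {RV P >-> R}).
Hypothesis iV : iid V.

Let X a := realisation (V \o a) : Omega -> sequences R nat.

Lemma bounded_rv_integralE (h : Omega -> R) : bounded_rv h ->
  (\int[P]_w (h w)%:E = (\int[P]_w h w)%:E)%E.
Proof.
move=> bh; rewrite /Rintegral fineK//; apply: integrable_fin_num => //.
exact: bounded_rv_integrable.
Qed.

Variables (g : sequences R nat -> R) (p W : R) (alpha : nat -> R).
Hypotheses (p2 : 2 < p) (mg : measurable_fun setT g).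
Hypothesis ig : P.-integrable setT (fun w => (g (X inl w))%:E).
Hypothesis alpha0 : forall k, 0 < alpha k.
Hypothesis resampling_bound : forall k,
  (\int[P]_w (`|g (X inl w) - g (X (resample k) w)| `^ p)%:E <= (alpha k `^ p)%:E)%E.
Hypothesis alphaW : forall N, \sum_(k < N) alpha k ^+ 2 <= W.

Let M : R := \int[P]_w g (X inl w).
Let f (n : nat) x := clamp n%:R (g x).
Let Mn (n : nat) : R := \int[P]_w f n (X inl w).

Let bf n : bounded_rv (f n).
Proof.
split; first exact: (measurableT_comp (@measurable_clamp R n%:R) mg).
by exists n%:R => x; exact: norm_clamp.
Qed.

Let bX (h : sequences R nat -> R) a : bounded_rv h ->
  bounded_rv (fun w => h (X a w)).
Proof.
move=> [mh [c hc]]; split; last by exists c.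
by apply: measurableT_comp => //; exact: measurable_realisation.
Qed.

Let mgX a : measurable_fun setT (fun w => g (X a w)).
Proof. by apply: measurableT_comp => //; exact: measurable_realisation. Qed.

Let p0 : 0 <= p. Proof. by rewrite (le_trans _ (ltW p2)). Qed.

Let meas_pow (h : Omega -> R) : measurable_fun setT h ->
  measurable_fun setT (fun w => (`|h w| `^ p)%:E).
Proof.
by move=> mh; apply/measurable_EFinP; exact: measurable_norm_powR.
Qed.

Let clamped_bound n :
  \int[P]_w `|f n (X inl w) - Mn n| `^ p <= (moment_constant p * W) `^ (p / 2).
Proof.
apply: (bounded_moment_inequality iV p2 (bf n) alpha0) => // k.
have b1 : bounded_rv (fun w => `|f n (X inl w) - f n (X (resample k) w)| `^ p).
  by apply: bounded_rv_powR => //; apply: bounded_rvB; exact: bX.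
rewrite -lee_fin -bounded_rv_integralE//; apply: le_trans (resampling_bound k).
apply: ge0_le_integral => //.
- by case: b1 => mb _; exact/measurable_EFinP.
- by apply: meas_pow; exact: measurable_funB.
- move=> w _; rewrite lee_fin; apply: ge0_ler_powR => //; rewrite ?nnegrE//.
  exact: clamp_contraction.
Qed.

Let Mn_cvg : Mn @ \oo --> M.
Proof.
have mE a : measurable_fun setT (fun w => (g (X a w))%:E) by exact/measurable_EFinP.
have [] := @dominated_convergence _ Omega R P setT measurableT
  (fun n w => (f n (X inl w))%:E) (fun w => (g (X inl w))%:E)
  (fun w => `|(g (X inl w))%:E|%E).
- by move=> n; apply/measurable_EFinP; case: (@bX (f n) inl (bf n)).
- exact: mE.
- apply: aeW => w _; apply: cvg_near_cst.
  exists (Num.truncn `|g (X inl w)|).+1 => // n /= kn.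
  congr EFin; apply: clamp_id; apply/ltW/(lt_le_trans (truncnS_gt _)).
  by rewrite ler_nat.
- exact: integrable_abse.
- by apply: aeW => w n _; rewrite lee_fin; exact: clamp_le_norm.
move=> _ _ H.
have MF : M%:E = (\int[P]_w (g (X inl w))%:E)%E.
  by rewrite /M /Rintegral fineK//; exact: integrable_fin_num.
move: H; rewrite -MF => /fine_cvgP[_].
by apply: cvg_trans; apply: near_eq_cvg; apply: nearW => n.
Qed.

(** The bounded inequality applies to the clamped functions, whose means converge
    to [M]; replacing the mean of the clamped function by [M] costs the factor
    [2 `^ p * 2], and Fatou's lemma removes the clamping. *)
Lemma moment_inequality :
  (\int[P]_w (`|g (X inl w) - M| `^ p)%:E <=
    (2 `^ p * (2 * (moment_constant p * W) `^ (p / 2)))%:E)%E.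
Proof.
set K := moment_constant p * W.
have W0 : 0 < W.
  by apply: lt_le_trans (alphaW 1); rewrite big_ord1 exprn_gt0.
have K0 : 0 < K by rewrite mulr_gt0// mulr_gt0.
have sK : K `^ (p / 2) = (Num.sqrt K) `^ p.
  by rewrite -powR12_sqrt ?(ltW K0)// -powRrM; congr powR; lra.
have s0 : 0 < Num.sqrt K by rewrite sqrtr_gt0.
have [n0 _ Hn0] : \forall n \near \oo, `|M - Mn n| <= Num.sqrt K.
  by have /cvgrPdist_le := Mn_cvg; apply.
have bound n : (n0 <= n)%N ->
    (\int[P]_w (`|f n (X inl w) - M| `^ p)%:E <= (2 `^ p * (2 * K `^ (p / 2)))%:E)%E.
  move=> /Hn0 /= hn.
  have b c : bounded_rv (fun w => `|f n (X inl w) - c| `^ p).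
    by apply: bounded_rv_powR => //; apply: bounded_rvB; [exact: bX|exact: bounded_rv_cst].
  rewrite bounded_rv_integralE// lee_fin.
  apply: (@le_trans _ _ (\int[P]_w (2 `^ p * (`|f n (X inl w) - Mn n| `^ p + K `^ (p / 2))))).
    apply: le_mean => //.
      apply: bounded_rvM; first exact: bounded_rv_cst.
      by apply: bounded_rvD => //; exact: bounded_rv_cst.
    move=> w; set a := `|f n (X inl w) - Mn n|.
    have ha : `|f n (X inl w) - M| <= a + Num.sqrt K.
      apply: le_trans (lerD (lexx _) hn).
      by rewrite (distrC M); apply: (le_trans _ (ler_normD _ _)); rewrite subrKA.
    have pa : 0 <= a `^ p by exact: powR_ge0.
    have ps : 0 <= K `^ (p / 2) by exact: powR_ge0.
    have a0 : 0 <= a by exact: normr_ge0.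
    suff H t : 0 <= t -> a <= t -> Num.sqrt K <= t ->
        `|f n (X inl w) - M| `^ p <= 2 `^ p * t `^ p.
      have [as_|/ltW sa] := leP a (Num.sqrt K).
        apply: (le_trans (H _ (ltW s0) as_ (lexx _))).
        by rewrite -sK ler_wpM2l ?powR_ge0// lerDr.
      apply: (le_trans (H _ a0 (lexx _) sa)).
      by rewrite ler_wpM2l ?powR_ge0// lerDl.
    move=> t0 at_ st; rewrite -powRM//; apply: ge0_ler_powR => //;
      rewrite ?nnegrE ?mulr_ge0//; lra.
  rewrite meanZ; last by apply: bounded_rvD => //; exact: bounded_rv_cst.
  rewrite ler_wpM2l ?powR_ge0// meanD ?mean_cst//; last exact: bounded_rv_cst.
  by have := clamped_bound n; rewrite -/K; lra.
pose F n w := (`|f (n + n0) (X inl w) - M| `^ p)%:E.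
have -> : (\int[P]_w (`|g (X inl w) - M| `^ p)%:E = \int[P]_w limn_einf (F ^~ w))%E.
  apply: eq_integral => w _.
  have Fw : F ^~ w @ \oo --> (`|g (X inl w) - M| `^ p)%:E.
    apply: cvg_near_cst.
    exists (Num.truncn `|g (X inl w)|).+1 => // n /= kn.
    rewrite /F /f clamp_id//; apply/ltW/(lt_le_trans (truncnS_gt _)).
    by rewrite ler_nat (leq_trans kn)// leq_addr.
  by have [-> _] := cvg_limn_einf_sup Fw.
apply: (le_trans (fatou P measurableT _ _)).
- move=> n; apply: meas_pow; apply: measurable_funB => //.
  by case: (@bX (f (n + n0)) inl (bf (n + n0))).
- by move=> n w _; rewrite lee_fin powR_ge0.
rewrite limn_einf_lim; apply: lime_le; first exact: is_cvg_einfs.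
apply: nearW => n; apply: (@le_trans _ _ (\int[P]_w F n w)%E).
  by apply: ereal_inf_lbound; exists n => //=.
by apply: bound; rewrite leq_addl.
Qed.

End moment_inequality.

(** * Bounds on [L^p] norms *)

Section lp_norm.
Context {disp : measure_display} {Omega : measurableType disp} {R : realType}.
Variable P : probability Omega R.
Implicit Types (f g : Omega -> R) (p A B : R).

Definition norm_le p f A : Prop := (Lnorm P p%:E (fun w => (f w)%:E) <= A%:E)%E.

Lemma norm_leP p f A : 0 < p -> 0 <= A ->
  norm_le p f A <-> (\int[P]_w (`|f w| `^ p)%:E <= (A `^ p)%:E)%E.
Proof.
move=> p0 A0; have pn0 : p != 0 by rewrite gt_eqF.
have E : (\int[P]_w (`|f w| `^ p)%:E = \int[P]_w (`|(f w)%:E| `^ p))%E by [].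
have I0 : (0 <= \int[P]_w (`|f w| `^ p)%:E)%E.
  by apply: integral_ge0 => w _; rewrite lee_fin powR_ge0.
rewrite /norm_le; split.
  move=> H; rewrite E -poweR_Lnorm// -poweR_EFin gt0_ler_poweR ?(ltW p0)//.
    by rewrite in_itv/= leey andbT Lnorm_ge0.
  by rewrite in_itv/= leey andbT lee_fin.
move=> H; have -> : A = (A `^ p) `^ p^-1 by rewrite -powRrM mulfV// powRr1.
rewrite unlock -E -poweR_EFin gt0_ler_poweR//.
- by rewrite invr_ge0 ltW.
- by rewrite in_itv/= leey andbT.
- by rewrite in_itv/= leey andbT lee_fin powR_ge0.
Qed.

Lemma norm_le_ge0 p f A : norm_le p f A -> 0 <= A.
Proof. by move=> H; rewrite -lee_fin (le_trans (Lnorm_ge0 _ _ _) H). Qed.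

Lemma norm_le_weak p f A B : A <= B -> norm_le p f A -> norm_le p f B.
Proof. by move=> AB /le_trans; apply; rewrite lee_fin. Qed.

Lemma norm_leD p f g A B : 1 <= p -> measurable_fun setT f -> measurable_fun setT g ->
  norm_le p f A -> norm_le p g B -> norm_le p (fun w => f w + g w) (A + B).
Proof.
move=> p1 mf mg fA gB; apply: (le_trans (minkowski_EFin P mf mg p1)).
by rewrite EFinD leeD.
Qed.

Lemma norm_leN p f A : norm_le p f A -> norm_le p (fun w => - f w) A.
Proof.
rewrite /norm_le -(oppe_Lnorm P (fun w => (f w)%:E)).
by apply: le_trans; rewrite le_eqVlt; apply/orP; left; apply/eqP/eq_Lnorm.
Qed.

Lemma norm_leB p f g A B : 1 <= p -> measurable_fun setT f -> measurable_fun setT g ->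
  norm_le p f A -> norm_le p g B -> norm_le p (fun w => f w - g w) (A + B).
Proof.
move=> p1 mf mg fA gB; apply: norm_leD => //; last exact: norm_leN.
exact: measurableT_comp.
Qed.

Lemma norm_le_cst p c A : 0 < p -> `|c| <= A -> norm_le p (fun=> c) A.
Proof.
move=> p0 cA; have A0 : 0 <= A by exact: le_trans cA.
apply/norm_leP => //; rewrite integral_cst//.
rewrite [X in (_ * X)%E](_ : _ = 1%E) ?mule1; last exact: probability_setT.
by rewrite lee_fin; apply: ge0_ler_powR => //; rewrite ?nnegrE// ltW.
Qed.

Lemma norm_le_sum p (I : Type) (s : seq I) (F : I -> Omega -> R) (A : I -> R) :
  1 <= p -> (forall i, measurable_fun setT (F i)) ->
  (forall i, norm_le p (F i) (A i)) ->
  norm_le p (fun w => \sum_(i <- s) F i w) (\sum_(i <- s) A i).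
Proof.
move=> p1 mF FA; elim: s => [|i s IH].
  under eq_fun do rewrite big_nil; rewrite big_nil.
  by apply: norm_le_cst; rewrite ?normr0 // (lt_le_trans ltr01).
under eq_fun do rewrite big_cons; rewrite big_cons.
by apply: norm_leD => //; exact: measurable_sum.
Qed.

Lemma norm_leZ p c f A : 0 < p -> measurable_fun setT f -> norm_le p f A ->
  norm_le p (fun w => c * f w) (`|c| * A).
Proof.
move=> p0 mf fA; have A0 := norm_le_ge0 fA.
move/(norm_leP _ p0 A0) : fA => fA; apply/norm_leP => //; first by rewrite mulr_ge0.
under eq_integral do rewrite normrM powRM// EFinM.
rewrite ge0_integralZl_EFin ?powR_ge0//; last first.
  by apply/measurable_EFinP; exact: measurable_norm_powR.
by rewrite powRM// EFinM lee_wpmul2l// lee_fin powR_ge0.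
Qed.

(** The Cauchy-Schwarz inequality for [|f|^p] and [|g|^p], obtained by integrating
    [2 u v <= u^2 + v^2] for the variables normalised by [A] and [B]. *)
Lemma norm_leM p f g A B : 0 < p -> 0 < A -> 0 < B ->
  measurable_fun setT f -> measurable_fun setT g ->
  norm_le (2 * p) f A -> norm_le (2 * p) g B ->
  norm_le p (fun w => f w * g w) (A * B).
Proof.
move=> p0 A0 B0 mf mg; have p20 : 0 < 2 * p by rewrite mulr_gt0.
move=> /(norm_leP _ p20 (ltW A0)) fA /(norm_leP _ p20 (ltW B0)) gB.
apply/norm_leP => //; first by rewrite mulr_ge0 ?ltW.
pose a := (A^-1) `^ (2 * p); pose b := (B^-1) `^ (2 * p).
pose c := 2^-1 * (A * B) `^ p.
have mpow (h : Omega -> R) : measurable_fun setT h ->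
    measurable_fun setT (fun w : Omega => (`|h w| `^ (2 * p))%:E).
  by move=> mh; apply/measurable_EFinP; exact: measurable_norm_powR.
have mpowZ k (h : Omega -> R) : measurable_fun setT h ->
    measurable_fun setT (fun w : Omega => (k%:E * (`|h w| `^ (2 * p))%:E)%E).
  by move=> mh; apply: emeasurable_funM => //; exact: mpow.
have a0 : 0 <= a by exact: powR_ge0.
have b0 : 0 <= b by exact: powR_ge0.
have c0 : 0 <= c by rewrite mulr_ge0// powR_ge0.
have pw0 k (h : Omega -> R) : 0 <= k -> forall w : Omega, setT w ->
    (0 <= k%:E * (`|h w| `^ (2 * p))%:E)%E.
  by move=> k0 w _; rewrite -EFinM lee_fin mulr_ge0// powR_ge0.
apply: (@le_trans _ _ (\int[P]_w (c%:E *
    (a%:E * (`|f w| `^ (2 * p))%:E + b%:E * (`|g w| `^ (2 * p))%:E)))%E).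
  apply: ge0_le_integral => //.
  - by apply/measurable_EFinP; apply: measurable_norm_powR; exact: measurable_funM.
  - by apply: emeasurable_funM => //; apply: emeasurable_funD; exact: mpowZ.
  - move=> w _; change ((`|f w * g w| `^ p)%:E <=
      (c * (a * `|f w| `^ (2 * p) + b * `|g w| `^ (2 * p)))%:E)%E.
    rewrite lee_fin normrM.
    have := normr_ge0 (g w); have := normr_ge0 (f w).
    move: `|f w| `|g w| => x y x0 y0.
    have Ai : 0 <= A^-1 by rewrite invr_ge0 ltW.
    have Bi : 0 <= B^-1 by rewrite invr_ge0 ltW.
    rewrite /a /b -!powRM//.
    set u := A^-1 * x; set v := B^-1 * y.
    have u0 : 0 <= u by rewrite mulr_ge0.
    have v0 : 0 <= v by rewrite mulr_ge0.
    have -> : x * y = (A * B) * (u * v).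
      by rewrite /u /v mulrACA !mulVKf// gt_eqF.
  
    have AB0 : 0 <= A * B by rewrite mulr_ge0 ?(ltW A0) ?(ltW B0).
    have uv0 : 0 <= u * v by rewrite mulr_ge0.
    rewrite (powRM _ AB0 uv0) (powRM _ u0 v0).
    rewrite (mulrC 2 p) !powRrM !powR_mulrn ?powR_ge0// /c.
    have ABp : 0 <= (A * B) `^ p by exact: powR_ge0.
    have : u `^ p * v `^ p <= 2^-1 * (u `^ p ^+ 2 + v `^ p ^+ 2).
      have := sqr_ge0 (u `^ p - v `^ p).
      by move: (u `^ p) (v `^ p) => s t; nra.
    by move=> /(ler_wpM2l ABp); lra.
rewrite ge0_integralZl_EFin//; last 2 first.
- by move=> w _; apply: adde_ge0; exact: pw0.
- by apply: emeasurable_funD; exact: mpowZ.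
rewrite ge0_integralD//; try (by exact: pw0); try exact: mpowZ.
have half k (h : Omega -> R) C : 0 < C -> k = C^-1 `^ (2 * p) -> measurable_fun setT h ->
    (\int[P]_w (`|h w| `^ (2 * p))%:E <= (C `^ (2 * p))%:E)%E ->
    (\int[P]_w (k%:E * (`|h w| `^ (2 * p))%:E) <= 1)%E.
  move=> C0 -> mh hC; rewrite ge0_integralZl_EFin ?powR_ge0//; last exact: mpow.
  apply: (@le_trans _ _ ((C^-1 `^ (2 * p))%:E * (C `^ (2 * p))%:E)%E).
    by apply: lee_wpmul2l => //; rewrite lee_fin powR_ge0.
  rewrite -EFinM -powRM ?invr_ge0 ?(ltW C0)// mulVf ?gt_eqF//.
  by rewrite powR1.
apply: (@le_trans _ _ (c%:E * (1 + 1))%E).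
  apply: lee_wpmul2l; first by rewrite lee_fin.
  apply: leeD; first exact: (half _ _ A).
  exact: (half _ _ B).
by rewrite -EFinD -EFinM lee_fin /c; lra.
Qed.

Lemma norm_le_integrable p f A : 1 <= p -> measurable_fun setT f -> norm_le p f A ->
  P.-integrable setT (fun w => (f w)%:E).
Proof.
move=> p1 mf fA; have A0 := norm_le_ge0 fA.
have p0 : 0 < p by exact: lt_le_trans p1.
move/(norm_leP _ p0 A0) : fA => fA.
have mp : measurable_fun setT (fun w => (`|f w| `^ p)%:E).
  by apply/measurable_EFinP; exact: measurable_norm_powR.
apply/integrableP; split; first exact/measurable_EFinP.
apply: (@le_lt_trans _ _ (\int[P]_w (1 + (`|f w| `^ p)%:E))%E).
  apply: ge0_le_integral => //.
  - by apply/measurable_EFinP; exact: measurableT_comp.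
  - exact: emeasurable_funD.
  - move=> w _ /=; rewrite -EFinD lee_fin.
    have pw := powR_ge0 `|f w| p.
    have [f1|/ltW f1] := leP `|f w| 1; first by lra.
    have : `|f w| `^ 1 <= `|f w| `^ p by apply: ler_powR.
    by rewrite powRr1//; lra.
rewrite ge0_integralD//.
rewrite integral_cst// mul1e.
rewrite [X in (X + _)%E](_ : _ = 1%E); last exact: probability_setT.
by rewrite lte_add_pinfty ?ltry// (le_lt_trans fA) ?ltry.
Qed.

End lp_norm.

(** * Partial sums of a causal process *)

Section series.
Context {R : realType}.

(** The coordinate [k] of the past of time [m] has lag [k - s] in the past of
    time [m - s], and does not occur there when [k < s]. *)
Definition causal (rho : nat -> R) (s k : nat) : R :=
  if (s <= k)%N then rho (k - s)%N else 0.

Variables (rho : nat -> R) (S : R).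
Hypotheses (rho0 : forall l, 0 < rho l) (rhoS : forall n, \sum_(l < n) rho l <= S).

Lemma causal_ge0 s k : 0 <= causal rho s k.
Proof. by rewrite /causal; case: ifP => // _; exact: ltW. Qed.

Lemma sum_causal_time s n : \sum_(k < n) causal rho s k <= S.
Proof.
apply: le_trans (rhoS (n - s)).
rewrite -(big_mkord xpredT (causal rho s)) -(big_mkord xpredT rho).
have [ns|sn] := leqP n s.
  rewrite big_nat big1 ?sumr_ge0// => [l _|k /andP[_ kn]]; first exact: ltW.
  by rewrite /causal leqNgt (leq_trans kn ns).
rewrite (big_cat_nat (n := s))//= ?(ltnW sn)// big_nat big1 ?add0r; last first.
  by move=> k /andP[_ ks]; rewrite /causal leqNgt ks.
rewrite -{1}(add0n s) big_addn; apply: ler_sum => k _.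
by rewrite /causal leq_addl addnK.
Qed.

Lemma sum_causal_shift m k : \sum_(s < m) causal rho s k <= S.
Proof.
apply: le_trans (rhoS k.+1).
apply: (@le_trans _ _ (\sum_(s < k.+1) causal rho s k)).
  rewrite -!(big_mkord xpredT (fun s => causal rho s k)).
  have [mk|km] := leqP m k.+1.
    rewrite [leRHS](big_cat_nat (n := m))//= lerDl.
    by apply: sumr_ge0 => s _; exact: causal_ge0.
  rewrite (big_cat_nat (n := k.+1))//= ?(ltnW km)// gerDl.
  rewrite big_nat big1// => s /andP[ks _].
  by rewrite /causal leqNgt ks.
rewrite (reindex_inj rev_ord_inj)/=; apply: ler_sum => s _.
by rewrite /causal subSS leq_subr subKn// -ltnS.
Qed.

Lemma sum_causal_gt0 m k : (0 < m)%N -> 0 < \sum_(s < m) causal rho s k.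
Proof.
case: m => // m _; rewrite big_ord_recl ltr_pwDl ?sumr_ge0//.
  by rewrite /causal leq0n.
by move=> s _; exact: causal_ge0.
Qed.

(** Each inner sum is at most [S], and so is the sum over [k] of the effects on
    one time; bounding one of the two factors of the square gives [m S^2], where
    adding up the effects first would give [m^2 S^2]. *)
Lemma sum_causal_sqr m N :
  \sum_(k < N) (\sum_(s < m) causal rho s k) ^+ 2 <= m%:R * S ^+ 2.
Proof.
have S0 : 0 <= S by have := rhoS 0; rewrite big_ord0.
apply: (@le_trans _ _ (\sum_(k < N) S * \sum_(s < m) causal rho s k)).
  apply: ler_sum => k _; rewrite expr2 ler_wpM2r ?sum_causal_shift//.
  by apply: sumr_ge0 => s _; exact: causal_ge0.
rewrite -mulr_sumr exchange_big/= mulrC expr2 mulrA ler_wpM2r//.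
rewrite -[m in m%:R]card_ord -sum1_card natr_sum mulr_suml.
by apply: ler_sum => s _; rewrite mul1r sum_causal_time.
Qed.

End series.

Section partial_sums.
Context {disp : measure_display} {Omega : measurableType disp} {R : realType}.
Variables (P : probability Omega R) (e e' : int -> {RV P >-> R}).
Hypothesis he : iid_uniform_with_copy e e'.

Definition with_copy (u : int + int) : {RV P >-> R} :=
  match u with inl t => e t | inr t => e' t end.

Lemma iid_with_copy : iid with_copy.
Proof.
case: he => ind U; split => // i j A mA.
have PU k : P (with_copy k @^-1` A) = uniform_prob (@ltr01 R) A.
  by case: k => t; [exact: (U t).1|exact: (U t).2].
by rewrite !PU.
Qed.

(** The past of time [m] of the innovations and of their copy, the most recent
    one first. *)
Definition past (m : nat) (i : nat + nat) : int + int :=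
  match i with inl k => inl (m%:Z - k%:Z) | inr k => inr (m%:Z - k%:Z) end.

Lemma past_inj m : injective (past m).
Proof. by move=> [i|i] [j|j] //= [] /addrI/oppr_inj/eqP; rewrite eqz_nat => /eqP ->. Qed.

Lemma iid_past m : iid (with_copy \o past m).
Proof. by apply: iid_reindex; [exact: past_inj|exact: iid_with_copy]. Qed.

Let X m a := realisation ((with_copy \o past m) \o a) : Omega -> sequences R nat.

Definition shift (s : nat) (x : sequences R nat) : sequences R nat :=
  fun k => x (k + s)%N.

Lemma measurable_shift s : measurable_fun setT (shift s).
Proof. exact: (measurable_reindex (fun k => k + s)%N). Qed.

Lemma history_shift m s w : (s <= m)%N ->
  history e (m - s)%N%:Z w = shift s (X m inl w).
Proof.
move=> sm; apply/funext => k.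
rewrite /history /shift /X /realisation /=; congr (e _ w).
by rewrite -subzn// PoszD opprD addrA addrAC.
Qed.

Lemma resample_shift m s k w : (s <= m)%N -> (s <= k)%N ->
  shift s (X m (resample k) w) =
  coupled_history e e' (m - s)%N%:Z ((m - s)%N%:Z - (k - s)%N%:Z) w.
Proof.
move=> sm sk; apply/funext => i.
rewrite /coupled_history /shift /X /realisation /= /resample.
have -> : ((m - s)%N%:Z - i%:Z == (m - s)%N%:Z - (k - s)%N%:Z) = (i + s == k)%N.
  rewrite (inj_eq (addrI _)) eqr_opp eqz_nat.
  by apply/eqP/eqP => [->|<-]; rewrite ?subnK ?addnK.
case: eqP => [ik|_] /=.
  congr (e' _ w); rewrite -ik addnK -subzn//.
  by rewrite PoszD opprD addrA addrAC.
congr (e _ w); rewrite -subzn//.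
by rewrite PoszD opprD addrA addrAC.
Qed.

Lemma resample_shift_past m s k w : (k < s)%N ->
  shift s (X m (resample k) w) = shift s (X m inl w).
Proof.
move=> ks; apply/funext => i; rewrite /shift /X /realisation /= /resample.
by rewrite gtn_eqF// (leq_trans ks)// leq_addl.
Qed.

Variables (H : nat -> (nat -> R) -> R) (p A S : R) (rho : nat -> R) (m : nat).
Hypotheses (p2 : 2 < p) (m0 : (0 < m)%N).
Hypothesis mH : forall t, (1 <= t)%N ->
  measurable_fun (setT : set (sequences R nat)) (H t).
Hypothesis HA : forall t, (1 <= t)%N -> norm_le P p (fun w => H t (history e t%:Z w)) A.
Hypothesis Hrho : forall t l, (1 <= t)%N -> norm_le P p (fun w =>
  H t (history e t%:Z w) - H t (coupled_history e e' t%:Z (t%:Z - l%:Z) w)) (rho l).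
Hypotheses (rho0 : forall l, 0 < rho l) (rhoS : forall n, \sum_(l < n) rho l <= S).

Let g (x : sequences R nat) : R := \sum_(s < m) H (m - s) (shift s x).

Let pos_time (s : 'I_m) : (1 <= m - s)%N. Proof. by rewrite subn_gt0. Qed.

Let mHs (s : 'I_m) : measurable_fun setT (fun x => H (m - s) (shift s x)).
Proof. exact: (measurableT_comp (mH (pos_time s)) (@measurable_shift s)). Qed.

Let mHX (s : 'I_m) a : measurable_fun setT (fun w => H (m - s) (shift s (X m a w))).
Proof.
exact: (measurableT_comp (mHs s) (measurable_realisation _)).
Qed.

(** The sum is a function of the past of time [m] alone. Resampling its
    coordinate [k] moves the summand at time [m - s] by at most
    [causal rho s k], so that [moment_inequality] applies with the bounds
    computed in [sum_causal_sqr]: the norm grows like the square root of [m]. *)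
Lemma partial_sum_norm_le :
  norm_le P p (fun w => \sum_(1 <= t < m.+1) H t (history e t%:Z w) -
     \int[P]_w \sum_(1 <= t < m.+1) H t (history e t%:Z w))
   (4 * Num.sqrt (moment_constant p * (m%:R * S ^+ 2))).
Proof.
have p1 : 1 <= p by rewrite (le_trans _ (ltW p2))// ler1n.
have p0 : 0 < p by rewrite (lt_le_trans _ p1).
have gE w : \sum_(1 <= t < m.+1) H t (history e t%:Z w) = g (X m inl w).
  rewrite big_add1 big_mkord (reindex_inj rev_ord_inj)/= /g.
  apply: eq_bigr => s _; rewrite subnSK//.
  by rewrite history_shift// ltnW.
have -> : (fun w => \sum_(1 <= t < m.+1) H t (history e t%:Z w) -
     \int[P]_w \sum_(1 <= t < m.+1) H t (history e t%:Z w)) =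
   (fun w => g (X m inl w) - \int[P]_w g (X m inl w)).
  apply/funext => w; rewrite gE; congr (_ - _).
  by apply: eq_Rintegral => w' _; rewrite gE.
have mg : measurable_fun setT g.
  by apply: measurable_sum => s; exact: mHs.
have gA : norm_le P p (fun w => g (X m inl w)) (\sum_(s < m) A).
  apply: norm_le_sum => // s.
  have := HA (pos_time s); congr (norm_le _ _ _ _); apply/funext => w.
  by rewrite history_shift// ltnW.
have ig : P.-integrable setT (fun w => (g (X m inl w))%:E).
  apply: norm_le_integrable gA => //.
  exact: (measurableT_comp mg (measurable_realisation _)).
pose alpha k := \sum_(s < m) causal rho s k.
have alpha0 k : 0 < alpha k by exact: sum_causal_gt0.
have W0 : 0 <= m%:R * S ^+ 2 by rewrite mulr_ge0 ?sqr_ge0.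
have K0 : 0 <= moment_constant p * (m%:R * S ^+ 2).
  by rewrite mulr_ge0// /moment_constant mulr_ge0.
have incr k : (\int[P]_w (`|g (X m inl w) - g (X m (resample k) w)| `^ p)%:E <=
    (alpha k `^ p)%:E)%E.
  apply/norm_leP => //; first exact: ltW.
  rewrite (_ : (fun w => _) = fun w => \sum_(s < m)
      (H (m - s) (shift s (X m inl w)) - H (m - s) (shift s (X m (resample k) w)))).
    apply: norm_le_sum => // s; first by apply: measurable_funB; exact: mHX.
    rewrite /causal; case: leqP => [sk|ks].
      have := Hrho (k - s) (pos_time s); congr (norm_le _ _ _ _).
      apply/funext => w; rewrite -resample_shift//; last exact: ltnW.
      by rewrite history_shift// ltnW.
    rewrite (_ : (fun w => _) = fun=> 0); first by apply: norm_le_cst; rewrite ?normr0.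
    by apply/funext => w; rewrite resample_shift_past// subrr.
  by apply/funext => w; rewrite /g sumrB.
have := moment_inequality (iid_past m) p2 mg ig alpha0 incr (sum_causal_sqr rho0 rhoS m).
move=> MI.
have B0 : 0 <= 4 * Num.sqrt (moment_constant p * (m%:R * S ^+ 2)).
  by rewrite mulr_ge0 ?sqrtr_ge0.
apply/(norm_leP _ _ p0 B0); apply: (le_trans MI); rewrite lee_fin.
set K := moment_constant p * _ in K0 *.
have -> : K `^ (p / 2) = (Num.sqrt K) `^ p.
  by rewrite -powR12_sqrt// -powRrM mulrC.
rewrite (_ : 4 = 2 * 2 :> R); last by rewrite -natrM.
rewrite -mulrA powRM ?mulr_ge0 ?sqrtr_ge0// powRM ?sqrtr_ge0//.
rewrite ler_wpM2l ?powR_ge0// ler_wpM2r ?powR_ge0//.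
rewrite -[leLHS](@powRr1 R)//; apply: ler_powR => //.
by rewrite ler1n.
Qed.

End partial_sums.

(** * The entries of the sample covariance matrix *)

Section rates.
Context {R : realType}.

Lemma sum_inv_sqr (n : nat) : \sum_(l < n) (l.+1%:R ^+ 2)^-1 <= 2 :> R.
Proof.
case: n => [|n]; first by rewrite big_ord0.
apply: (@le_trans _ _ (2 - n.+1%:R^-1)); last by rewrite gerBl invr_ge0.
elim: n => [|n IH]; first by rewrite big_ord1 expr1n invr1; lra.
rewrite big_ord_recr/=; apply: (le_trans (lerD IH (lexx _))).
have n0 : 0 < n.+1%:R :> R by rewrite ltr0n.
rewrite -(natr1 n.+1); move: n.+1%:R n0 => x x0.
suff : ((x + 1) ^+ 2)^-1 <= x^-1 - (x + 1)^-1 by lra.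
have -> : x^-1 - (x + 1)^-1 = (x * (x + 1))^-1.
  by field; rewrite !gt_eqF//; lra.
rewrite lef_pV2 ?posrE; [nra| |]; nra.
Qed.

(** One summable sequence that dominates the coupling bound [C1 l^(-beta)] at all
    lags [l >= 1] (as [l^(-beta) <= l^(-2) <= 4 (l+1)^(-2)]) and, at lag 0, twice
    the bound [2 K + 1] on the norm of an observation. *)
Definition coupling_scale (K C1 : R) : R := 4 * (`|C1| + 1) + 2 * (2 * K + 1).

Definition coupling_rate (K C1 : R) (l : nat) : R :=
  coupling_scale K C1 * (l.+1%:R ^+ 2)^-1.

Lemma decay_le_coupling_rate K C1 beta l : 2 < beta -> 0 <= K -> (1 <= l)%N ->
  C1 * l%:R `^ (- beta) <= coupling_rate K C1 l.
Proof.
move=> b2 K0 l1; have l1R : 1 <= l%:R :> R by rewrite ler1n.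
have l0 : 0 < l%:R :> R by rewrite ltr0n.
have pl : 0 <= l%:R `^ (- beta) :> R by exact: powR_ge0.
apply: (@le_trans _ _ (`|C1| * (l%:R ^+ 2)^-1)).
  apply: (le_trans (ler_wpM2r pl (ler_norm C1))); apply: ler_wpM2l => //.
  apply: (@le_trans _ _ (l%:R `^ (- 2))); first by apply: ler_powR => //; lra.
  by rewrite powRN powR_mulrn// ltW.
have C0 : 0 <= `|C1| by exact: normr_ge0.
apply: (@le_trans _ _ (4 * `|C1| * (l.+1%:R ^+ 2)^-1)).
  rewrite -(natr1 l); move: l%:R l1R l0 C0 {pl} => x x1 x0 C0.
  have x2 : 0 < x ^+ 2 by rewrite exprn_gt0.
  have y2 : 0 < (x + 1) ^+ 2 by rewrite exprn_gt0//; lra.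
  have : (x ^+ 2)^-1 <= 4 * ((x + 1) ^+ 2)^-1.
    rewrite -[leLHS]mul1r ler_pdivrMr// mulrAC ler_pdivlMr// mul1r.
    nra.
  by move=> /(ler_wpM2l C0) /le_trans; apply; rewrite mulrCA mulrA.
rewrite /coupling_rate ler_wpM2r ?invr_ge0 ?sqr_ge0// /coupling_scale; lra.
Qed.

(** Constants in the bounds of order [m^(-1/2)] on the errors of the sample mean,
    of the sample second moments and of the sample covariances. *)
Definition mean_constant (q K C1 : R) : R :=
  4 * Num.sqrt (moment_constant q) * (2 * coupling_scale K C1).

Definition second_moment_constant (q K C1 : R) : R :=
  4 * Num.sqrt (moment_constant (q / 2)) *
    (2 * (2 * (2 * K + 1) * coupling_scale K C1)).

Definition covariance_constant (q K C1 : R) : R :=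
  second_moment_constant q K C1 + (mean_constant q K C1 ^+ 2 +
    2 * (mean_constant q K C1 * (2 * K + 1))).

Lemma moment_constant_gt0 (p : R) : 0 < moment_constant p.
Proof. by rewrite /moment_constant mulr_gt0. Qed.

Lemma coupling_scale_gt0 K C1 : 0 <= K -> 0 < coupling_scale K C1.
Proof. by move=> K0; have := normr_ge0 C1; rewrite /coupling_scale; lra. Qed.

Lemma mean_constant_gt0 q K C1 : 0 <= K -> 0 < mean_constant q K C1.
Proof.
move=> K0; have := coupling_scale_gt0 C1 K0.
have : 0 < Num.sqrt (moment_constant q) by rewrite sqrtr_gt0 moment_constant_gt0.
by move=> h1 h2; rewrite !mulr_gt0.
Qed.

End rates.

Section sample_covariance.
Context {disp : measure_display} {Omega : measurableType disp} {R : realType}.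
Variables (P : probability Omega R) (d : nat) (Y : nat -> Omega -> 'cV[R]_d).
Variable m : nat.

Lemma mx_expectationE (a b : nat) (X : Omega -> 'M[R]_(a, b)) i j :
  mx_expectation P X i j = \int[P]_w X w i j.
Proof. by rewrite mxE unlock. Qed.

Lemma sample_meanE w i :
  sample_mean Y m w i 0 = m%:R^-1 * \sum_(1 <= t < m.+1) Y t w i 0.
Proof. by rewrite mxE summxE. Qed.

Lemma sample_second_momentE w i j : sample_second_moment Y m w i j =
  m%:R^-1 * \sum_(1 <= t < m.+1) Y t w i 0 * Y t w j 0.
Proof.
rewrite mxE summxE; congr (_ * _); apply: eq_bigr => t _.
by rewrite mxE big_ord1 mxE.
Qed.

Lemma sample_covE w i j : (0 < m)%N -> sample_cov Y m w i j =
  sample_second_moment Y m w i j - sample_mean Y m w i 0 * sample_mean Y m w j 0.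
Proof.
move=> m0; have mn0 : m%:R != 0 :> R by rewrite pnatr_eq0 -lt0n.
rewrite sample_second_momentE mxE summxE.
have Sm k : \sum_(1 <= t < m.+1) Y t w k 0 = m%:R * sample_mean Y m w k 0.
  by rewrite sample_meanE mulVKf.
have -> : \sum_(1 <= t < m.+1) ((Y t w - sample_mean Y m w) *m
      (Y t w - sample_mean Y m w)^T) i j =
    \sum_(1 <= t < m.+1) Y t w i 0 * Y t w j 0 -
      m%:R * (sample_mean Y m w i 0 * sample_mean Y m w j 0).
  move: (sample_mean Y m w) Sm => a Sm.
  transitivity (\sum_(1 <= t < m.+1)
      (Y t w i 0 * Y t w j 0 - Y t w i 0 * a j 0 - (a i 0 * Y t w j 0 - a i 0 * a j 0))).
    by apply: eq_bigr => t _; rewrite mxE big_ord1 !mxE; ring.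
  rewrite !sumrB -mulr_suml -mulr_sumr !Sm.
  by rewrite sumr_const_nat subSS subn0 -mulr_natl; ring.
by rewrite mulrBr mulKf.
Qed.

Lemma avg_covE i j : avg_cov P Y m i j =
  \int[P]_w sample_second_moment Y m w i j -
    (\int[P]_w sample_mean Y m w i 0) * \int[P]_w sample_mean Y m w j 0.
Proof.
transitivity (avg_second_moment P Y m i j - avg_mean P Y m i 0 * avg_mean P Y m j 0).
  rewrite /avg_cov mxE [X in _ + X]mxE; congr (_ - _).
  by rewrite mxE big_ord1; congr (_ * _); rewrite mxE.
by rewrite !mx_expectationE.
Qed.

Lemma sample_cov_sym w i j : (0 < m)%N -> sample_cov Y m w i j = sample_cov Y m w j i.
Proof.
move=> m0; rewrite !sample_covE// !sample_second_momentE mulrC [in RHS]mulrC.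
congr (_ * _ - _); last by rewrite mulrC.
by apply: eq_bigr => t _; rewrite mulrC.
Qed.

Lemma avg_cov_sym i j : avg_cov P Y m i j = avg_cov P Y m j i.
Proof.
rewrite !avg_covE; congr (_ - _); last by rewrite mulrC.
apply: eq_Rintegral => w _; rewrite !sample_second_momentE; congr (_ * _).
by apply: eq_bigr => t _; rewrite mulrC.
Qed.

End sample_covariance.

Section integrable_sum.
Context {disp : measure_display} {Omega : measurableType disp} {R : realType}.
Variable P : probability Omega R.

Lemma Rintegral_sum (I : Type) (s : seq I) (F : I -> Omega -> R) :
  (forall i, P.-integrable setT (fun w => (F i w)%:E)) ->
  \int[P]_w (\sum_(i <- s) F i w) = \sum_(i <- s) \int[P]_w F i w.
Proof.
move=> iF; elim: s => [|i s IH].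
  by under eq_Rintegral do rewrite big_nil; rewrite big_nil mean_cst.
under eq_Rintegral do rewrite big_cons.
have iS : P.-integrable setT (EFin \o (fun w => \sum_(j <- s) F j w)).
  rewrite (_ : EFin \o _ = (fun w => \sum_(i <- s) (F i w)%:E)%E).
    by apply: integrable_sum => // k _; exact: iF.
  by apply/funext => w /=; rewrite sumEFin.
have -> := @RintegralD _ _ _ P setT (F i) (fun w => \sum_(j <- s) F j w)
  measurableT (iF i) iS.
by rewrite IH big_cons.
Qed.

End integrable_sum.

Section covariance_entries.
Context {disp : measure_display} {Omega : measurableType disp} {R : realType}.
Variables (P : probability Omega R) (e e' : int -> {RV P >-> R}).
Variables (d : nat) (G : nat -> (nat -> R) -> 'cV[R]_d).
Variables (beta q K C1 : R) (m : nat).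
Hypotheses (beta2 : 2 < beta) (q4 : 4 < q) (m0 : (0 < m)%N).
Hypothesis he : iid_uniform_with_copy e e'.
Hypothesis hG : measurable_maps G.
Hypothesis hA : cond_moment_decay e e' G beta q K C1.

Let Y := observation e G.
Let y (i : 'I_d) t (x : nat -> R) : R := G t x i 0.
Let Kb : R := 2 * K + 1.

Let K0 : 0 <= K.
Proof. by have [H _] := hA (leqnn 1); apply: le_trans H; rewrite /mx_norm. Qed.

Let Kb0 : 0 < Kb. Proof. by rewrite /Kb; move: K0; lra. Qed.

Let q1 : 1 <= q. Proof. by move: q4; lra. Qed.
Let q0 : 0 < q. Proof. by move: q4; lra. Qed.

Let my i t : (1 <= t)%N -> measurable_fun (setT : set (sequences R nat)) (y i t).
Proof. by move=> t1; exact: hG. Qed.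

Let mean_bound t i : (1 <= t)%N -> `|mean_vector e G t i 0| <= K.
Proof.
move=> t1; have [H _] := hA t1; apply: le_trans H.
rewrite mx_normrE.
exact: (le_bigmax 0 (fun ij => `|mean_vector e G t ij.1 ij.2|) (i, 0)).
Qed.

Lemma norm_le_law p (F : sequences R nat -> R) (a b : nat -> int + int) A :
  0 < p -> injective a -> injective b -> measurable_fun setT F ->
  norm_le P p (fun w => F (realisation (with_copy e e' \o a) w)) A ->
  norm_le P p (fun w => F (realisation (with_copy e e' \o b) w)) A.
Proof.
move=> p0 ia ib mF FA; have A0 := norm_le_ge0 FA.
move/(norm_leP P _ p0 A0) : FA => FA; apply/(norm_leP P _ p0 A0).
apply: le_trans FA; rewrite le_eqVlt; apply/orP; left; apply/eqP/esym.
apply: (@ge0_integral_reindex _ _ _ P _ _ (with_copy e e') a b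
  (fun x => (`|F x| `^ p)%:E)) => //.
- exact: iid_with_copy.
- by apply/measurable_EFinP; exact: measurable_norm_powR.
Qed.

Let past_inl_inj t : injective (past t \o inl).
Proof. by apply: inj_comp; [exact: past_inj|move=> ? ? []]. Qed.

Let observation_norm t i : (1 <= t)%N ->
  norm_le P q (fun w => y i t (history e t%:Z w)) Kb.
Proof.
move=> t1; have [_ /(_ i)[H _]] := hA t1.
have H0 : norm_le P q (fun w => y i t (history e 0 w) - mean_vector e G t i 0) K by exact: H.
have mh s : measurable_fun setT (fun w => y i t (history e s%:Z w)).
  exact: (measurableT_comp (my i t1)
    (measurable_realisation (with_copy e e' \o (past s \o inl)))).
have H1 : norm_le P q (fun w => y i t (history e 0 w)) Kb.
  rewrite (_ : (fun w => _) = fun w =>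
    y i t (history e 0 w) - mean_vector e G t i 0 + mean_vector e G t i 0).
    apply: (@norm_le_weak _ _ _ _ _ _ (K + K)); first by rewrite /Kb; lra.
    apply: norm_leD => //; first exact: measurable_funB (mh 0%N) _.
    by apply: norm_le_cst => //; exact: mean_bound.
  by apply/funext => w; rewrite subrK.
exact: (@norm_le_law q (y i t) (past 0 \o inl) (past t \o inl) Kb q0
  (@past_inl_inj 0) (@past_inl_inj t) (my i t1) H1).
Qed.

Let coupled_norm t i l : (1 <= t)%N ->
  norm_le P q (fun w => y i t (coupled_history e e' t%:Z (t%:Z - l%:Z) w)) Kb.
Proof.
move=> t1.
have ir : injective (past t \o resample l).
  by apply: inj_comp; [exact: past_inj|exact: resample_inj].
have := @norm_le_law q (y i t) (past t \o inl) (past t \o resample l) Kb q0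
  (@past_inl_inj t) ir (my i t1) (observation_norm i t1).
congr (norm_le _ _ _ _); apply/funext => w; congr (y i t _).
have := resample_shift e e' w (leq0n t) (leq0n l); rewrite !subn0 => <-.
by apply/funext => k; rewrite /shift addn0.
Qed.

Let measurable_history i t : (1 <= t)%N ->
  measurable_fun setT (fun w => y i t (history e t%:Z w)).
Proof.
move=> t1; exact: (measurableT_comp (my i t1)
  (measurable_realisation (fun k => e (t%:Z - k%:Z)))).
Qed.

Let measurable_coupled i t l : (1 <= t)%N ->
  measurable_fun setT (fun w => y i t (coupled_history e e' t%:Z (t%:Z - l%:Z) w)).
Proof.
move=> t1.
have := measurableT_comp (my i t1)
  (measurable_realisation (with_copy e e' \o (past t \o resample l))).
congr (measurable_fun _ _); apply/funext => w; congr (y i t _).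
have := resample_shift e e' w (leq0n t) (leq0n l); rewrite !subn0 => <-.
by apply/funext => k; rewrite /shift addn0.
Qed.

Let coupling t i l : (1 <= t)%N ->
  norm_le P q (fun w => y i t (history e t%:Z w) -
    y i t (coupled_history e e' t%:Z (t%:Z - l%:Z) w)) (coupling_rate K C1 l).
Proof.
move=> t1; case: l => [|l].
  apply: (@norm_le_weak _ _ _ _ _ _ (Kb + Kb)).
    rewrite /coupling_rate expr1n invr1 mulr1 /coupling_scale /Kb.
    by have := normr_ge0 C1; lra.
  by apply: norm_leB => //; [exact: measurable_history|exact: measurable_coupled|
    exact: observation_norm|exact: coupled_norm].
have [_ /(_ i)[_ /(_ l.+1 isT) H]] := hA t1.
by apply: norm_le_weak H; exact: decay_le_coupling_rate.
Qed.

Let coupling_rate0 l : 0 < coupling_rate K C1 l.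
Proof. by rewrite mulr_gt0 ?coupling_scale_gt0// invr_gt0 exprn_gt0. Qed.

Let coupling_rateS n : \sum_(l < n) coupling_rate K C1 l <= 2 * coupling_scale K C1.
Proof.
rewrite -mulr_sumr mulrC ler_wpM2r ?sum_inv_sqr//.
by rewrite ltW// coupling_scale_gt0.
Qed.

Let sm : R := Num.sqrt m%:R.
Let sm0 : 0 < sm. Proof. by rewrite sqrtr_gt0 ltr0n. Qed.
Let smE : m%:R = sm * sm. Proof. by rewrite -expr2 sqr_sqrtr. Qed.
Let sm1 : 1 <= sm.
Proof. by rewrite -[leLHS]sqrtr1 ler_wsqrtr// ler1n. Qed.

Let sqrt_split c S : 0 <= c -> 0 <= S ->
  4 * Num.sqrt (c * (m%:R * S ^+ 2)) = 4 * Num.sqrt c * S * sm.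
Proof.
move=> c0 S0; rewrite sqrtrM// sqrtrM ?ler0n// sqrtr_sqr ger0_norm// -/sm; ring.
Qed.

Let sum_norm i :
  norm_le P q (fun w => \sum_(1 <= t < m.+1) y i t (history e t%:Z w) -
     \int[P]_w \sum_(1 <= t < m.+1) y i t (history e t%:Z w))
    (mean_constant q K C1 * sm).
Proof.
have q2 : 2 < q by move: q4; lra.
have := @partial_sum_norm_le _ _ _ P e e' he (y i) q Kb
  (2 * coupling_scale K C1) (coupling_rate K C1) m q2 m0 (my i)
  (fun t => @observation_norm t i) (fun t l => @coupling t i l) coupling_rate0 coupling_rateS.
rewrite sqrt_split//; first exact: ltW (moment_constant_gt0 _).
by rewrite mulr_ge0// ltW// coupling_scale_gt0.
Qed.

(* The product of two components is again a causal process, with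
   [a b - a' b' = (a - a') b + a' (b - b')]; its moments exist up to order
   [q / 2], which exceeds 2. *)
Let prod_norm i j :
  norm_le P (q / 2) (fun w =>
     \sum_(1 <= t < m.+1) y i t (history e t%:Z w) * y j t (history e t%:Z w) -
     \int[P]_w \sum_(1 <= t < m.+1) y i t (history e t%:Z w) * y j t (history e t%:Z w))
    (second_moment_constant q K C1 * sm).
Proof.
have q2 : 2 < q / 2 by move: q4; lra.
have qh0 : 0 < q / 2 by move: q4; lra.
have qh1 : 1 <= q / 2 by move: q4; lra.
have qE : 2 * (q / 2) = q by rewrite mulrC divfK.
pose rho l := 2 * Kb * coupling_rate K C1 l.
have rho0 l : 0 < rho l by rewrite mulr_gt0// mulr_gt0.
have rhoS n : \sum_(l < n) rho l <= 2 * (2 * Kb * coupling_scale K C1).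
  rewrite -mulr_sumr [leRHS]mulrCA ler_wpM2l//.
  by rewrite mulr_ge0// ltW.
have mp t : (1 <= t)%N ->
    measurable_fun (setT : set (sequences R nat)) (fun x => y i t x * y j t x).
  by move=> t1; apply: measurable_funM; exact: my.
have Hp t : (1 <= t)%N ->
    norm_le P (q / 2) (fun w => y i t (history e t%:Z w) * y j t (history e t%:Z w)) (Kb * Kb).
  move=> t1; apply: norm_leM => //; rewrite ?qE;
    first [exact: measurable_history|exact: observation_norm].
have Hc t l : (1 <= t)%N -> norm_le P (q / 2) (fun w =>
    y i t (history e t%:Z w) * y j t (history e t%:Z w) -
    y i t (coupled_history e e' t%:Z (t%:Z - l%:Z) w) *
    y j t (coupled_history e e' t%:Z (t%:Z - l%:Z) w)) (rho l).
  move=> t1.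
  have mh k := measurable_history k t1.
  have mc k := @measurable_coupled k t l t1.
  rewrite (_ : (fun w => _) = fun w =>
    (y i t (history e t%:Z w) - y i t (coupled_history e e' t%:Z (t%:Z - l%:Z) w)) *
     y j t (history e t%:Z w) +
    y i t (coupled_history e e' t%:Z (t%:Z - l%:Z) w) *
    (y j t (history e t%:Z w) - y j t (coupled_history e e' t%:Z (t%:Z - l%:Z) w))).
    rewrite (_ : rho l = coupling_rate K C1 l * Kb + Kb * coupling_rate K C1 l); last first.
      by rewrite /rho; ring.
    apply: norm_leD => //.
    - by apply: measurable_funM => //; exact: measurable_funB.
    - by apply: measurable_funM => //; exact: measurable_funB.
    - apply: norm_leM => //; rewrite ?qE.
      + exact: measurable_funB.
      + exact: coupling.
      + exact: observation_norm.
    - apply: norm_leM => //; rewrite ?qE.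
      + exact: measurable_funB.
      + exact: coupled_norm.
      + exact: coupling.
  by apply/funext => w; ring.
have := @partial_sum_norm_le _ _ _ P e e' he (fun t x => y i t x * y j t x) (q / 2) (Kb * Kb)
  (2 * (2 * Kb * coupling_scale K C1)) rho m q2 m0 mp Hp Hc rho0 rhoS.
rewrite sqrt_split//; first exact: ltW (moment_constant_gt0 _).
by rewrite !mulr_ge0// ?ltW// coupling_scale_gt0.
Qed.

Let msum (F : nat -> Omega -> R) :
  (forall t, (1 <= t)%N -> measurable_fun setT (F t)) ->
  measurable_fun setT (fun w => \sum_(1 <= t < m.+1) F t w).
Proof.
move=> mF; under eq_fun do rewrite big_add1 big_mkord.
by apply: measurable_sum => s; exact: mF.
Qed.

Let obs_integrable t i : (1 <= t)%N -> P.-integrable setT (fun w => (Y t w i 0)%:E).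
Proof.
by move=> t1; apply: (norm_le_integrable q1 (measurable_history i t1) (observation_norm i t1)).
Qed.

Let measurable_mean i : measurable_fun setT (fun w => sample_mean Y m w i 0).
Proof.
under eq_fun do rewrite sample_meanE.
by apply: measurable_funM => //; apply: msum => t t1; exact: measurable_history.
Qed.

Let measurable_second i j : measurable_fun setT (fun w => sample_second_moment Y m w i j).
Proof.
under eq_fun do rewrite sample_second_momentE.
apply: measurable_funM => //; apply: msum => t t1.
by apply: measurable_funM; exact: measurable_history.
Qed.

Lemma measurable_sample_cov i j : measurable_fun setT (fun w => sample_cov Y m w i j).
Proof.
under eq_fun do rewrite sample_covE//.
by apply: measurable_funB => //; apply: measurable_funM.
Qed.

Let centred_norm p (S : Omega -> R) c : 1 <= p -> measurable_fun setT S ->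
  P.-integrable setT (fun w => (S w)%:E) ->
  norm_le P p (fun w => S w - \int[P]_w S w) (c * sm) ->
  norm_le P p (fun w => m%:R^-1 * S w - \int[P]_w (m%:R^-1 * S w)) (c / sm).
Proof.
move=> p1 mS iS SA; have p0 : 0 < p by exact: lt_le_trans p1.
rewrite (_ : c / sm = `|m%:R^-1| * (c * sm)); last first.
  rewrite ger0_norm ?invr_ge0// smE; field.
  by rewrite gt_eqF.
rewrite (_ : (fun w => _) = fun w => m%:R^-1 * (S w - \int[P]_w S w)).
  by apply: norm_leZ => //; exact: measurable_funB.
by apply/funext => w; rewrite RintegralZl// mulrBr.
Qed.

Let sum_integrable (F : nat -> Omega -> R) :
  (forall t, (1 <= t)%N -> P.-integrable setT (fun w => (F t w)%:E)) ->
  P.-integrable setT (fun w => (\sum_(1 <= t < m.+1) F t w)%:E).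
Proof.
move=> iF.
rewrite (_ : (fun w => _) = (fun w => \sum_(s <- index_enum 'I_m) (F s.+1 w)%:E)%E).
  by apply: integrable_sum => // s _; exact: iF.
by apply/funext => w; rewrite big_add1 big_mkord sumEFin.
Qed.

Let mu i := \int[P]_w sample_mean Y m w i 0.

Let mu_bound i : `|mu i| <= Kb.
Proof.
have -> : mu i = m%:R^-1 * \sum_(s < m) mean_vector e G s.+1 i 0.
  rewrite /mu; under eq_Rintegral do rewrite sample_meanE.
  rewrite RintegralZl//; last first.
    by apply: sum_integrable => t; exact: obs_integrable.
  congr (_ * _); under eq_Rintegral do rewrite big_add1 big_mkord.
  rewrite Rintegral_sum; last by move=> s; exact: obs_integrable.
  by apply: eq_bigr => s _; rewrite mx_expectationE.
rewrite normrM ger0_norm ?invr_ge0// ler_pdivrMl ?ltr0n//.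
apply: (le_trans (ler_norm_sum _ _ _)).
rewrite mulr_natl -[m in _ *+ m]card_ord -sumr_const; apply: ler_sum => s _.
apply: (le_trans (mean_bound i _)) => //; rewrite /Kb; move: K0; lra.
Qed.

Let mean_norm i :
  norm_le P q (fun w => sample_mean Y m w i 0 - mu i) (mean_constant q K C1 / sm).
Proof.
pose S w := \sum_(1 <= t < m.+1) Y t w i 0.
rewrite (_ : (fun w => _) =
    fun w => m%:R^-1 * S w - \int[P]_w (m%:R^-1 * S w)); last first.
  apply/funext => w; rewrite sample_meanE; congr (_ - _).
  by apply: eq_Rintegral => w' _; rewrite sample_meanE.
apply: centred_norm => //.
- by apply: msum => t t1; exact: measurable_history.
- by apply: sum_integrable => t; exact: obs_integrable.
- exact: sum_norm.
Qed.

Let second_norm i j :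
  norm_le P (q / 2) (fun w => sample_second_moment Y m w i j -
    \int[P]_w sample_second_moment Y m w i j) (second_moment_constant q K C1 / sm).
Proof.
have qh1 : 1 <= q / 2 by move: q4; lra.
have qE : 2 * (q / 2) = q by rewrite mulrC divfK.
pose S w := \sum_(1 <= t < m.+1) Y t w i 0 * Y t w j 0.
rewrite (_ : (fun w => _) =
    fun w => m%:R^-1 * S w - \int[P]_w (m%:R^-1 * S w)); last first.
  apply/funext => w; rewrite sample_second_momentE; congr (_ - _).
  by apply: eq_Rintegral => w' _; rewrite sample_second_momentE.
have mt t : (1 <= t)%N -> measurable_fun setT (fun w => Y t w i 0 * Y t w j 0).
  by move=> t1; apply: measurable_funM; exact: measurable_history.
apply: centred_norm => //.
- exact: msum.
- apply: sum_integrable => t t1.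
  apply: (@norm_le_integrable _ _ _ P (q / 2) _ (Kb * Kb)) => //; first exact: mt.
  apply: norm_leM => //; rewrite ?qE;
    first [exact: measurable_history|exact: observation_norm|by move: q4; lra].
- exact: prod_norm.
Qed.

(** With [dl] the error of the sample mean, the error of the covariance is the
    error of the second moment minus
    [dl i * dl j + dl i * mu j + mu i * dl j]. *)
Lemma covariance_entry_norm_le i j :
  norm_le P (q / 2) (fun w => sample_cov Y m w i j - avg_cov P Y m i j)
    (covariance_constant q K C1 / sm).
Proof.
have qh1 : 1 <= q / 2 by move: q4; lra.
have qh0 : 0 < q / 2 by move: q4; lra.
have qE : 2 * (q / 2) = q by rewrite mulrC divfK.
have c0 : 0 < mean_constant q K C1 by exact: mean_constant_gt0.
set c := mean_constant q K C1 in c0 *; set c2 := second_moment_constant q K C1.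
have cs0 : 0 < c / sm by rewrite divr_gt0.
pose dl k w := sample_mean Y m w k 0 - mu k.
have mdl k : measurable_fun setT (dl k) by exact: measurable_funB.
have dlq k : norm_le P (2 * (q / 2)) (dl k) (c / sm) by rewrite qE; exact: mean_norm.
have muq k : norm_le P (2 * (q / 2)) (fun=> mu k) Kb.
  by rewrite qE; apply: norm_le_cst => //; exact: mu_bound.
rewrite (_ : (fun w => _) = fun w =>
   sample_second_moment Y m w i j - (\int[P]_w sample_second_moment Y m w i j) -
   (dl i w * dl j w + (dl i w * mu j + mu i * dl j w))); last first.
  apply/funext => w; rewrite sample_covE// avg_covE /dl -/(mu i) -/(mu j).
  ring.
apply: (@norm_le_weak _ _ _ _ _ _
  (c2 / sm + (c / sm * (c / sm) + (c / sm * Kb + Kb * (c / sm))))).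
  have h : c / sm * (c / sm) <= c ^+ 2 / sm.
    have s1 : sm^-1 <= 1 by rewrite invf_le1.
    have s0 : 0 <= sm^-1 by rewrite invr_ge0 ltW.
    rewrite mulrACA expr2; apply: ler_wpM2l; first by rewrite mulr_ge0 ?(ltW c0).
    by rewrite -[leRHS]mulr1 ler_wpM2l.
  rewrite /covariance_constant -/c -/c2 -/Kb.
  rewrite (_ : (c2 + (c ^+ 2 + 2 * (c * Kb))) / sm =
    c2 / sm + (c ^+ 2 / sm + (c / sm * Kb + Kb * (c / sm)))); last by ring.
  by rewrite lerD2l lerD2r.
have m1 : measurable_fun setT (fun w => dl i w * dl j w) by exact: measurable_funM.
have m2 : measurable_fun setT (fun w => dl i w * mu j) by exact: measurable_funM.
have m3 : measurable_fun setT (fun w => mu i * dl j w) by exact: measurable_funM.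
have m4 : measurable_fun setT (fun w => dl i w * mu j + mu i * dl j w).
  exact: measurable_funD.
apply: (norm_leB qh1 _ _ (second_norm i j)).
- exact: measurable_funB.
- exact: measurable_funD.
apply: norm_leD => //; first exact: norm_leM.
by apply: norm_leD => //; exact: norm_leM.
Qed.

End covariance_entries.

(** * Thresholding and the operator norm *)

Section operator_norm.
Context {R : realType} {n : nat}.
Implicit Types (A : 'M[R]_n) (x : 'cV[R]_n).

Lemma opnorm_bound A c : 0 <= c ->
  (forall x, \sum_i (A *m x) i 0 ^+ 2 <= c ^+ 2 * \sum_i x i 0 ^+ 2) ->
  `|opnorm A| <= c.
Proof.
move=> c0 H; pose E := [set l2norm (A *m x) | x in [set x : 'cV[R]_n | l2norm x <= 1]].
have ubE : ubound E c.
  move=> _ [x /= x1 <-]; apply: (@le_trans _ _ (Num.sqrt (c ^+ 2 * \sum_i x i 0 ^+ 2))).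
    by apply: ler_wsqrtr; exact: H.
  by rewrite sqrtrM ?sqr_ge0// sqrtr_sqr ger0_norm// -[leRHS]mulr1 ler_wpM2l.
have E0 : E 0.
  exists 0 => /=; rewrite /l2norm ?mulmx0.
    by rewrite big1 ?sqrtr0// => i _; rewrite mxE expr0n.
  by rewrite big1 ?sqrtr0// => i _; rewrite mxE expr0n.
have s0 : 0 <= opnorm A by apply: ub_le_sup => //; exists c.
by rewrite ger0_norm//; apply: ge_sup => //; exists 0.
Qed.

Lemma cauchy_schwarz (a b : 'I_n -> R) :
  (\sum_i a i * b i) ^+ 2 <= (\sum_i a i ^+ 2) * \sum_i b i ^+ 2.
Proof.
set X := \sum_i a i ^+ 2; set Y := \sum_i b i ^+ 2; set Z := \sum_i a i * b i.
have X0 : 0 <= X by apply: sumr_ge0 => i _; exact: sqr_ge0.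
have Y0 : 0 <= Y by apply: sumr_ge0 => i _; exact: sqr_ge0.
have H s : 0 <= X - 2 * s * Z + s ^+ 2 * Y.
  have <- : \sum_i (a i - s * b i) ^+ 2 = X - 2 * s * Z + s ^+ 2 * Y.
    rewrite /X /Y /Z !mulr_sumr -sumrB -big_split/=.
    by apply: eq_bigr => i _; ring.
  by apply: sumr_ge0 => i _; exact: sqr_ge0.
have [Y00|Yn0] := eqVneq Y 0.
  have [->|Zn0] := eqVneq Z 0; first by rewrite expr0n mulr_ge0.
  have := H ((X + 1) / (2 * Z)); rewrite Y00 mulr0 addr0.
  have -> : 2 * ((X + 1) / (2 * Z)) * Z = X + 1 by field.
  by rewrite opprD addrA subrr sub0r ler0N1.
have Y1 : 0 < Y by rewrite lt0r Yn0.
have := H (Z / Y).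
have -> : X - 2 * (Z / Y) * Z + (Z / Y) ^+ 2 * Y = (X * Y - Z ^+ 2) / Y by field.
by rewrite pmulr_lge0 ?invr_gt0// subr_ge0.
Qed.

Lemma frobenius_bound A x :
  \sum_i (A *m x) i 0 ^+ 2 <= (\sum_i \sum_j A i j ^+ 2) * \sum_j x j 0 ^+ 2.
Proof.
by rewrite mulr_suml; apply: ler_sum => i _; rewrite mxE; exact: cauchy_schwarz.
Qed.

(** Schur's test: the Cauchy-Schwarz inequality with the weights [|A i j|] in each
    row, and the column sums to add the rows up. *)
Lemma schur_bound A x c : 0 <= c -> (forall i, \sum_j `|A i j| <= c) ->
  (forall j, \sum_i `|A i j| <= c) ->
  \sum_i (A *m x) i 0 ^+ 2 <= c ^+ 2 * \sum_j x j 0 ^+ 2.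
Proof.
move=> c0 Hr Hc.
apply: (@le_trans _ _ (\sum_i c * \sum_j `|A i j| * x j 0 ^+ 2)).
  apply: ler_sum => i _; rewrite mxE.
  have h : 0 <= \sum_j `|A i j| * x j 0 ^+ 2.
    by apply: sumr_ge0 => j _; rewrite mulr_ge0// sqr_ge0.
  apply: le_trans (ler_wpM2r h (Hr i)).
  have := cauchy_schwarz (fun j => Num.sqrt `|A i j|)
    (fun j => Num.sqrt `|A i j| * (Num.sg (A i j) * x j 0)).
  have -> : \sum_j Num.sqrt `|A i j| * (Num.sqrt `|A i j| * (Num.sg (A i j) * x j 0)) =
      \sum_j A i j * x j 0.
    apply: eq_bigr => j _; rewrite mulrA -expr2 sqr_sqrtr// mulrA.
    by rewrite (mulrC `|_|) -numEsg.
  have -> : \sum_j Num.sqrt `|A i j| ^+ 2 = \sum_j `|A i j|.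
    by apply: eq_bigr => j _; rewrite sqr_sqrtr.
  move=> /le_trans; apply; apply: ler_wpM2l; first exact: sumr_ge0.
  apply: ler_sum => j _; rewrite !exprMn sqr_sqrtr// ler_wpM2l// sqr_sg.
  by case: (_ != 0); rewrite ?mul1r// mul0r sqr_ge0.
rewrite -mulr_sumr expr2 -mulrA ler_wpM2l// exchange_big/= mulr_sumr.
apply: ler_sum => j _; rewrite -mulr_suml ler_wpM2r//; exact: sqr_ge0.
Qed.

End operator_norm.

Section thresholding.
Context {R : realType}.
Implicit Types (s a t r p : R) (f : R -> R).

(** An entry estimated within half the threshold is either set to zero, and then
    it is at most [3 t / 2] itself, or kept, and then it is at least [t / 2] while
    the error is at most [3 t / 2]. In both cases the error is at most three times
    the minimum of [t] and [|a|], hence of [t^(1-r) |a|^r]; zero entries are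
    always recovered exactly. *)
Lemma threshold_small_error f t r s a : soft_threshold t f -> 0 < t ->
  0 <= r -> r < 1 -> `|s - a| <= t / 2 ->
  `|f s - a| <= if a != 0 then 3 * t `^ (1 - r) * `|a| `^ r else 0.
Proof.
move=> /(_ s)[_ f0 fs] t0 r0 r1 sa.
have r1' : 0 <= 1 - r by lra.
have split_pow x : 0 < x -> x = x `^ r * x `^ (1 - r).
  move=> x0; rewrite -powRD ?subrKC ?powRr1 ?(ltW x0)//.
  by rewrite (gt_eqF x0) implybT.
have sa2 : `|a| <= `|s| + t / 2.
  by have := ler_normB s (s - a); rewrite opprB addrCA subrr addr0; lra.
have sa3 : `|s| <= `|a| + t / 2.
  by have := ler_normD a (s - a); rewrite addrCA subrr addr0; lra.
have [st|ts] := leP `|s| t.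
  rewrite f0// sub0r normrN; have [->|an0] := eqVneq a 0; first by rewrite normr0.
  rewrite /= mulrC.
  have a0 : 0 < `|a| by rewrite normr_gt0.
  rewrite {1}(split_pow _ a0) ler_wpM2l ?powR_ge0//.
  apply: (@le_trans _ _ ((3 * t) `^ (1 - r))).
    by apply: ge0_ler_powR => //; rewrite ?nnegrE//; lra.
  rewrite powRM//; last exact: ltW.
  rewrite ler_wpM2r ?powR_ge0// -[leRHS](@powRr1 R)//.
  by apply: ler_powR; lra.
have an0 : a != 0 by apply/eqP => a0; move: sa3; rewrite a0 normr0; lra.
rewrite an0.
have err : `|f s - a| <= 3 / 2 * t.
  have := ler_normD (f s - s) (s - a); rewrite addrA subrK.
  by move=> /le_trans; apply; lra.
apply: (le_trans err).
have tr : t `^ r <= 2 * `|a| `^ r.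
  apply: (@le_trans _ _ ((2 * `|a|) `^ r)).
    by apply: ge0_ler_powR => //; rewrite ?nnegrE ?mulr_ge0// ?(ltW t0)//; lra.
  rewrite powRM// ler_wpM2r ?powR_ge0// -[leRHS](@powRr1 R)//.
  by apply: ler_powR; lra.
rewrite [X in 3 / 2 * X](split_pow _ t0).
have := ler_wpM2r (powR_ge0 t (1 - r)) tr; lra.
Qed.

Lemma threshold_large_error f t s a : soft_threshold t f -> t / 2 < `|s - a| ->
  `|f s - a| <= 3 * `|s - a|.
Proof.
move=> /(_ s)[_ _ fs] sa; have := ler_normD (f s - s) (s - a); rewrite addrA subrK.
by move=> /le_trans; apply; lra.
Qed.

Lemma sqr_le_powR t p x : 2 < p -> 0 < t -> t < `|x| ->
  x ^+ 2 <= (t `^ (p - 2))^-1 * `|x| `^ p.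
Proof.
move=> p2 t0 tx.
have <- : x ^+ 2 * `|x| `^ (p - 2) = `|x| `^ p.
  by have := mul_signed_power x p2; rewrite /signed_power => <-; ring.
have tp : 0 < t `^ (p - 2) by rewrite powR_gt0.
rewrite mulrCA ler_peMr ?sqr_ge0// mulrC ler_pdivlMr// mul1r.
by apply: ge0_ler_powR => //; rewrite ?nnegrE ?(ltW t0) ?(ltW tx)//; lra.
Qed.

(** The first term bounds the rows of the well estimated entries, the second one
    the Frobenius norm of the others. *)
Definition threshold_constant (r p sbar C Lam : R) : R :=
  2 * (3 * C `^ (1 - r) * `|sbar| + 3 * Num.sqrt (((C / 2) `^ (p - 2))^-1 * Lam)).

(** The error matrix is split according to whether an entry is estimated within
    half the threshold. Schur's test and sparsity bound the [good] part. The
    number of [bad] entries is unknown, but their squared Frobenius norm is at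
    most [9 (t / 2)^(2-p)] times the sum of all [p]-th powers of the errors, that
    is, of order [rho ^+ 2]. *)
Lemma threshold_opnorm (n : nat) (S T : 'M[R]_n) f (r p sbar C Lam rho : R) :
  0 <= r -> r < 1 -> 2 < p -> 0 < C -> 0 <= Lam -> 0 < rho -> rho <= 1 ->
  soft_threshold (C * rho) f ->
  (forall i j, S i j = S j i) -> (forall i j, T i j = T j i) ->
  (forall i, \sum_(j | T i j != 0) `|T i j| `^ r <= sbar) ->
  \sum_i \sum_j `|S i j - T i j| `^ p <= Lam * rho `^ p ->
  `|opnorm (map_mx f S - T)| <= threshold_constant r p sbar C Lam * rho `^ (1 - r).
Proof.
move=> r0 r1 p2 C0 Lam0 rho0 rho1 hf symS symT rowT SLam.
set t := C * rho in hf.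
have t0 : 0 < t by rewrite mulr_gt0.
pose E := map_mx f S - T.
have EE i j : E i j = f (S i j) - T i j by rewrite !mxE.
pose good : 'M[R]_n := \matrix_(i, j) if `|S i j - T i j| <= t / 2 then E i j else 0.
pose bad : 'M[R]_n := \matrix_(i, j) if `|S i j - T i j| <= t / 2 then 0 else E i j.
have Egb : E = good + bad.
  by apply/matrixP => i j; rewrite !mxE; case: ifP; rewrite ?addr0 ?add0r.
pose c1 := 3 * t `^ (1 - r) * `|sbar|.
pose K2 := ((C / 2) `^ (p - 2))^-1 * Lam.
pose c2 := 3 * Num.sqrt K2 * rho.
have K20 : 0 <= K2 by rewrite mulr_ge0// invr_ge0 powR_ge0.
have c10 : 0 <= c1 by rewrite !mulr_ge0// powR_ge0.
have c20 : 0 <= c2 by rewrite !mulr_ge0// ?sqrtr_ge0// ltW.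
have row i : \sum_j `|good i j| <= c1.
  apply: (@le_trans _ _ (\sum_j if T i j != 0 then 3 * t `^ (1 - r) * `|T i j| `^ r else 0)).
    apply: ler_sum => j _; rewrite mxE; case: ifP => h.
      by rewrite EE; exact: threshold_small_error.
    by rewrite normr0; case: ifP => // _; rewrite !mulr_ge0// powR_ge0.
  rewrite -big_mkcond/= -mulr_sumr; apply: ler_wpM2l.
    by rewrite mulr_ge0// powR_ge0.
  exact: le_trans (rowT i) (ler_norm _).
have col j : \sum_i `|good i j| <= c1.
  apply: le_trans (row j); apply: ler_sum => i _.
  by rewrite !mxE (symS i j) (symT i j).
have fro : \sum_i \sum_j bad i j ^+ 2 <= c2 ^+ 2.
  have -> : c2 ^+ 2 = 9 * ((t / 2) `^ (p - 2))^-1 * (Lam * rho `^ p).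
    rewrite /c2 !exprMn sqr_sqrtr// /K2.
    have -> : t / 2 = (C / 2) * rho by rewrite /t mulrAC.
    have Ch : 0 <= C / 2 by rewrite divr_ge0// ltW.
    have := mul_signed_power rho p2; rewrite /signed_power (ger0_norm (ltW rho0)) => <-.
    rewrite (powRM (p - 2) Ch (ltW rho0)) invfM.
    have : (rho `^ (p - 2))^-1 * rho `^ (p - 2) = 1.
      by rewrite mulVf// gt_eqF// powR_gt0.
    have -> : 3 ^+ 2 = 9 :> R by rewrite -natrX.
    move: (((C / 2) `^ (p - 2))^-1) (rho `^ (p - 2)) ((rho `^ (p - 2))^-1) => x y z zy.
    rewrite -[LHS]mulr1 -zy; ring.
  apply: le_trans (ler_wpM2l _ SLam); last first.
    by rewrite mulr_ge0// invr_ge0 powR_ge0.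
  rewrite mulr_sumr; apply: ler_sum => i _; rewrite mulr_sumr; apply: ler_sum => j _.
  rewrite mxE; case: ifPn => [_|]; last rewrite -ltNge => h.
    by rewrite expr0n !mulr_ge0 ?invr_ge0 ?powR_ge0.
  have th : 0 < t / 2 by rewrite divr_gt0.
  rewrite -mulrA; apply: le_trans (ler_wpM2l _ (sqr_le_powR p2 th h)) => //.
  have -> : 9 = 3 ^+ 2 :> R by rewrite -natrX.
  rewrite -exprMn -ler_sqrt ?sqr_ge0// !sqrtr_sqr normrM (ger0_norm (ler0n _ 3)) EE.
  exact: threshold_large_error.
have sq2 (a b : R) : (a + b) ^+ 2 <= 2 * a ^+ 2 + 2 * b ^+ 2.
  by have := sqr_ge0 (a - b); nra.
have main : `|opnorm E| <= 2 * (c1 + c2).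
  apply: opnorm_bound => [|x]; first by rewrite mulr_ge0// addr_ge0.
  have X0 : 0 <= \sum_i x i 0 ^+ 2 by apply: sumr_ge0 => i _; exact: sqr_ge0.
  apply: (@le_trans _ _ (2 * (\sum_i (good *m x) i 0 ^+ 2) + 2 * \sum_i (bad *m x) i 0 ^+ 2)).
    rewrite !mulr_sumr -big_split/=; apply: ler_sum => i _.
    by rewrite Egb mulmxDl mxE sq2.
  have h1 := schur_bound x c10 row col.
  have h2 := le_trans (frobenius_bound bad x) (ler_wpM2r X0 fro).
  apply: (@le_trans _ _ ((2 * c1 ^+ 2 + 2 * c2 ^+ 2) * \sum_i x i 0 ^+ 2)); first lra.
  by apply: ler_wpM2r => //; nra.
apply: (le_trans main); rewrite /threshold_constant -mulrA ler_wpM2l//.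
rewrite mulrDl; apply: lerD.
  by rewrite /c1 /t powRM ?(ltW C0) ?(ltW rho0)// le_eqVlt; apply/orP; left; apply/eqP; ring.
rewrite /c2 -/K2 ler_wpM2l ?mulr_ge0 ?sqrtr_ge0//.
rewrite -[leLHS](@powRr1 R) ?(ltW rho0)//; apply: ger_powR; first by rewrite rho0.
lra.
Qed.

End thresholding.

(** * Consistency of the thresholded estimator *)

Section markov.
Context {disp : measure_display} {Omega : measurableType disp} {R : realType}.
Variable P : probability Omega R.

Lemma integral_sum_le (n : nat) (F : 'I_n -> Omega -> R) (c : R) :
  (forall i, measurable_fun setT (F i)) -> (forall i w, 0 <= F i w) ->
  (forall i, (\int[P]_w (F i w)%:E <= c%:E)%E) ->
  (\int[P]_w (\sum_i F i w)%:E <= (n%:R * c)%:E)%E.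
Proof.
move=> mF F0 Fc.
under eq_integral do rewrite -sumEFin.
rewrite ge0_integral_sum//; last 2 first.
- by move=> i; exact/measurable_EFinP.
- by move=> i w _; rewrite lee_fin.
apply: (@le_trans _ _ (\sum_(i < n) c%:E)%E); first by apply: lee_sum => i _.
by rewrite sumEFin lee_fin sumr_const card_ord mulr_natl.
Qed.

Lemma markov_tail (Z : Omega -> R) (a b delta : R) :
  measurable_fun setT Z -> (forall w, 0 <= Z w) -> 0 < a ->
  (\int[P]_w (Z w)%:E <= b%:E)%E -> b <= delta * a ->
  measurable [set w | a < Z w] /\ (P [set w | (a < Z w)%R] <= delta%:E)%E.
Proof.
move=> mZ Z0 a0 Zb ba; set A := [set w | a < Z w].
have mA : measurable A.
  rewrite (_ : A = Z @^-1` `]a, +oo[); first by rewrite -[_ @^-1` _]setTI; exact: mZ.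
  by apply/seteqP; split => w /=; rewrite in_itv/= andbT.
split=> //.
have m1 : measurable_fun setT (fun w => (\1_A w : R)%:E).
  exact/measurable_EFinP/measurable_indic.
have : (a%:E * P A <= b%:E)%E.
  have -> : (a%:E * P A = \int[P]_w (a%:E * (\1_A w)%:E))%E.
    rewrite ge0_integralZl_EFin ?(ltW a0)// integral_indic// setIT//.
  apply: le_trans Zb; apply: ge0_le_integral => //.
  - by move=> w _; rewrite -EFinM lee_fin mulr_ge0 ?(ltW a0)// indicE.
  - exact: emeasurable_funM.
  - exact/measurable_EFinP.
  - move=> w _; rewrite -EFinM lee_fin indicE; case: (boolP (w \in A)) => [/set_mem/ltW|_].
      by rewrite mulr1.
    by rewrite mulr0.
rewrite -(fineK (probability_fin P mA)) -EFinM !lee_fin => h.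
by rewrite -(ler_pM2l a0) (le_trans h)// mulrC.
Qed.

End markov.

Lemma rate_le1 (R : realType) (q : R) (d m : nat) : 0 < q -> (0 < m)%N ->
  d%:R <= m%:R `^ (q / 8) :> R -> rate q d m <= 1.
Proof.
move=> q0 m0 dm; rewrite /rate ler_pdivrMr ?sqrtr_gt0 ?ltr0n// mul1r.
have q4 : 0 <= 4 / q by rewrite divr_ge0// ltW.
have -> : Num.sqrt m%:R = (m%:R `^ (q / 8)) `^ (4 / q) :> R.
  rewrite -powRrM -powR12_sqrt//; congr powR; field.
  by rewrite gt_eqF.
by apply: ge0_ler_powR => //; rewrite nnegrE ?powR_ge0.
Qed.

(** The rate is chosen so that a union bound over the [d ^+ 2] entries costs
    nothing. *)
Lemma rate_powR (R : realType) (q : R) (d m : nat) : 0 < q ->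
  rate q d m `^ (q / 2) = d%:R ^+ 2 * (Num.sqrt m%:R)^-1 `^ (q / 2) :> R.
Proof.
move=> q0; rewrite /rate powRM ?powR_ge0 ?invr_ge0 ?sqrtr_ge0//; congr (_ * _).
rewrite -powRrM -powR_mulrn//; congr powR; field.
by rewrite gt_eqF.
Qed.

Unset Implicit Arguments.

Theorem theorem7 (R : realType) (disp : measure_display)
    (Omega : measurableType disp) (P : probability Omega R)
    (e e' : nat -> int -> {RV P >-> R})
    (d : nat -> nat) (G : forall m : nat, nat -> (nat -> R) -> 'cV[R]_(d m))
    (beta q K C1 L r M eps0 sbar : R) (s0 : nat -> R) (thr : R -> R -> R)
    (hbeta : 2 < beta) (hq : 4 < q) (hL : 0 < L)
    (hr0 : 0 <= r) (hr1 : r < 1) (heps0 : 0 < eps0)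
    (hs0 : forall n, s0 n <= sbar)
    (hd : forall m, (1 <= m)%N -> (1 <= d m)%N)
    (he : forall m, (1 <= m)%N -> iid_uniform_with_copy (e m) (e' m))
    (hG : forall m, (1 <= m)%N -> measurable_maps (G m))
    (hAi : forall m, (1 <= m)%N ->
       cond_moment_decay (e m) (e' m) (G m) beta q K C1)
    (hAii : forall m, (1 <= m)%N -> cond_variation (e m) (G m) K L)
    (hU : forall m, (1 <= m)%N ->
       sparse_class r (s0 (d m)) M eps0 (avg_cov P (observation (e m) (G m)) m))
    (hdo : (fun m : nat => (d m)%:R : R) =o_\oo
             (fun m : nat => m%:R `^ (q / 8) : R))
    (hthr : forall t : R, 0 < t -> soft_threshold t (thr t)) :
  exists2 C0 : R, 0 < C0 & forall Cth : R, C0 <= Cth ->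
    bigO_P P
      (fun m w => opnorm
         (map_mx (thr (Cth * rate q (d m) m))
            (sample_cov (observation (e m) (G m)) m w)
          - avg_cov P (observation (e m) (G m)) m))
      (fun m => rate q (d m) m `^ (1 - r)).
Proof.
exists 1 => // Cth Cth1 delta delta0.
have Cth0 : 0 < Cth by rewrite (lt_le_trans ltr01).
have q0 : 0 < q by lra.
have p2 : 2 < q / 2 by lra.
have p0 : 0 < q / 2 by lra.
have K0 : 0 <= K.
  by have [H _] := hAi 1%N (leqnn 1) 1%N (leqnn 1); apply: le_trans H; rewrite /mx_norm.
set c := covariance_constant q K C1.
have c0 : 0 <= c.
  have h1 := mean_constant_gt0 q C1 K0; have h2 := coupling_scale_gt0 C1 K0.
  have Kb : 0 <= 2 * K + 1 by lra.
  have h1' := ltW h1; have h2' := ltW h2.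
  apply: addr_ge0; last by apply: addr_ge0; [exact: sqr_ge0|rewrite !mulr_ge0].
  by rewrite !mulr_ge0// sqrtr_ge0.
(* By Markov's inequality the sum of the [q / 2]-th powers of the entrywise
   errors exceeds [Lam] times that power of the rate with probability at most
   [delta]; the [+ 1] makes [Lam] positive. *)
pose Lam := c `^ (q / 2) / delta + 1.
have cp0 : 0 <= c `^ (q / 2) by exact: powR_ge0.
have Lam0 : 0 < Lam by rewrite ltr_wpDl// divr_ge0// ltW.
pose B := threshold_constant r (q / 2) sbar Cth Lam + 1.
have T0 : 0 <= threshold_constant r (q / 2) sbar Cth Lam.
  by rewrite mulr_ge0// addr_ge0// !mulr_ge0// ?powR_ge0 ?sqrtr_ge0.
exists B; first by rewrite ltr_wpDl.
have rate1 : \forall m \near \oo, rate q (d m) m <= 1.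
  have := (eqoP _ _ _).1 hdo 1 ltr01.
  have h1 : \forall m \near \oo, (1 <= m)%N by exists 1%N.
  move=> h2; near=> m; have m1 : (0 < m)%N by near: m.
  apply: rate_le1 => //; have : `|(d m)%:R : R| <= 1 * `|m%:R `^ (q / 8) : R| by near: m.
  by rewrite mul1r !ger0_norm// powR_ge0.
near=> m.
have m0 : (0 < m)%N by near: m; exists 1%N.
have d0 := hd m m0.
have rho1 : rate q (d m) m <= 1 by near: m.
set rho := rate q (d m) m in rho1 *.
have sm0 : 0 < Num.sqrt m%:R :> R by rewrite sqrtr_gt0 ltr0n.
have rho0 : 0 < rho by rewrite divr_gt0// powR_gt0// ltr0n.
set S := sample_cov (observation (e m) (G m)) m.
set T := avg_cov P (observation (e m) (G m)) m.
have entry i j : norm_le P (q / 2) (fun w => S w i j - T i j) (c / Num.sqrt m%:R).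
  exact: (covariance_entry_norm_le hbeta hq m0 (he m m0) (hG m m0) (hAi m m0)).
have mS i j : measurable_fun setT (fun w => S w i j).
  exact: (measurable_sample_cov (e m) m0 (hG m m0)).
pose F (i j : 'I_(d m)) w := `|S w i j - T i j| `^ (q / 2).
have mF i j : measurable_fun setT (F i j).
  by apply: measurable_norm_powR; exact: measurable_funB.
have F0 i j w : 0 <= F i j w by exact: powR_ge0.
pose Z w := \sum_i \sum_j F i j w.
have mZ : measurable_fun setT Z.
  by apply: measurable_sum => i; exact: measurable_sum.
have Z0 w : 0 <= Z w by apply: sumr_ge0 => i _; apply: sumr_ge0 => j _.
have EZ : (\int[P]_w (Z w)%:E <= (c `^ (q / 2) * rho `^ (q / 2))%:E)%E.
  have -> : c `^ (q / 2) * rho `^ (q / 2) =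
      (d m)%:R * ((d m)%:R * (c / Num.sqrt m%:R) `^ (q / 2)).
    by rewrite rate_powR// (powRM _ c0) ?invr_ge0 ?(ltW sm0)//; ring.
  apply: integral_sum_le => [i|i w|i].
  - exact: measurable_sum.
  - exact: sumr_ge0.
  - apply: integral_sum_le => // j.
    exact: (norm_leP P _ p0 (norm_le_ge0 (entry i j))).1 (entry i j).
have rp0 : 0 < rho `^ (q / 2) by rewrite powR_gt0.
have LamE : c `^ (q / 2) * rho `^ (q / 2) <= delta * (Lam * rho `^ (q / 2)).
  rewrite mulrA ler_wpM2r ?(ltW rp0)// /Lam mulrDr mulrCA divff ?gt_eqF// !mulr1.
  by rewrite lerDl ltW.
have [mA PA] := @markov_tail _ _ _ P Z (Lam * rho `^ (q / 2)) _ delta mZ Z0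
  (mulr_gt0 Lam0 rp0) EZ LamE.
apply: le_trans PA; rewrite -(measurable_mu_extE P mA); apply: le_mu_ext => w /=.
rewrite ltNge; apply: contraPP => /negP; rewrite -leNgt => ZL; apply/negP; rewrite negbK.
rewrite (ger0_norm (powR_ge0 _ _)).
apply: (@le_trans _ _ (threshold_constant r (q / 2) sbar Cth Lam * rho `^ (1 - r))).
  apply: threshold_opnorm => //.
  - exact: ltW.
  - by apply: hthr; rewrite mulr_gt0.
  - by move=> i j; exact: sample_cov_sym.
  - by move=> i j; exact: avg_cov_sym.
  - move=> i; have [/(_ i)[_ H] _] := hU m m0; exact: le_trans H (hs0 _).
by rewrite ler_wpM2r ?powR_ge0// lerDl.
Unshelve. all: by end_near. Qed.
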